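(* Let $\delta>\frac{\pi^2}{4}-1$, $\alpha_0\in\mathbb{R}\setminus\{0\}$ and $\sigma_0^2\in[0,\infty)$. For $\sigma_w^2>0$ let $(\alpha_t,\sigma_t^2)$ be the real SE sequences with noise level $\sigma_w^2$ and set $\mathrm{AMSE}(\sigma_w^2,\delta):=\lim_{t\to\infty}\big[(1-|\alpha_t|)^2+\sigma_t^2\big]$. Then this limit exists for all sufficiently small $\sigma_w^2>0$, and $$\lim_{\sigma_w^2\to0}\frac{\mathrm{AMSE}(\sigma_w^2,\delta)}{\sigma_w^2}=\frac{1}{\big(1+\frac4{\pi^2}\big)^{-1}-\frac1\delta}.$$
   Context: Real state evolution. Fix $\delta>0$, $\sigma_w^2\ge0$. For $\alpha\in\mathbb{R}$, $\sigma^2\ge0$, $(\alpha,\sigma^2)\ne(0,0)$, with $\sigma=\sqrt{\sigma^2}$ and the convention $\arctan(\alpha/0)=\frac\pi2\,\mathrm{sign}(\alpha)$, define $$\psi_1(\alpha,\sigma^2)=\frac2\pi\arctan\Big(\frac\alpha\sigma\Big),\qquad \psi_2(\alpha,\sigma^2;\delta,\sigma_w^2)=\frac1\delta\Big[\alpha^2+\sigma^2+1-\frac{4\sigma}{\pi}-\frac{4\alpha}{\pi}\arctan\Big(\frac\alpha\sigma\Big)\Big]+\sigma_w^2 .$$ The real SE sequences are $\alpha_{t+1}=\psi_1(\alpha_t,\sigma_t^2)$, $\sigma_{t+1}^2=\psi_2(\alpha_t,\sigma_t^2;\delta,\sigma_w^2)$, $t\ge0$. *)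

(* Defs.v *)
From Stdlib Require Import Reals Lra.
Open Scope R_scope.

Definition rsign (a : R) : R :=
  if Rlt_dec 0 a then 1 else if Rlt_dec a 0 then -1 else 0.

Definition atan_ratio (alpha sigma : R) : R :=
  if Req_EM_T sigma 0 then PI / 2 * rsign alpha else atan (alpha / sigma).

Definition psi1 (alpha s2 : R) : R :=
  2 / PI * atan_ratio alpha (sqrt s2).

Definition psi2 (alpha s2 delta sw2 : R) : R :=
  / delta * (alpha ^ 2 + s2 + 1 - 4 * sqrt s2 / PI
             - 4 * alpha / PI * atan_ratio alpha (sqrt s2)) + sw2.

Fixpoint SE (delta sw2 a0 s0 : R) (t : nat) : R * R :=
  match t with
  | O => (a0, s0)
  | S t' => let '(a, s) := SE delta sw2 a0 s0 t' in
            (psi1 a s, psi2 a s delta sw2)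
  end.

Definition alpha_t (delta sw2 a0 s0 : R) (t : nat) : R := fst (SE delta sw2 a0 s0 t).
Definition sigma2_t (delta sw2 a0 s0 : R) (t : nat) : R := snd (SE delta sw2 a0 s0 t).

Definition mse_t (delta sw2 a0 s0 : R) (t : nat) : R :=
  (1 - Rabs (alpha_t delta sw2 a0 s0 t)) ^ 2 + sigma2_t delta sw2 a0 s0 t.

(* Main.v *)
Require Import Defs.
From Stdlib Require Import Reals Lra Lia Psatz Factorial.
Open Scope R_scope.

(* Write th = atan (alpha / sigma), p = 4 / PI^2 and Q = delta (psi2 - sigma_w^2).
   Global part.  For x > 0 put a = acot x; the region alpha >= 2 a / PI,
   sigma^2 <= (2 / PI) a x^2 alpha satisfies th >= a and Q <= (1 - p) th a x^2,
   by the one-variable inequality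
     1 - p th^2 - 2 p th cot th - (1 - 2 p) (th cot th)^2 <= 0.
   Since (1 - p) / delta < p when delta > PI^2 / 4 - 1, two noiseless iterations
   multiply x by a constant < 1, and noise w does not spoil this until x^2 is of
   order w.  So eventually 1 - alpha = O(sqrt w) and sigma^2 = O(w).
   Local part.  In that box the map is, in the coordinates
   (e, v) = ((1 - alpha)^2, sigma^2), an O(sqrt w)-perturbation of the affine map
   (e, v) |-> (p v, (e + v) / delta + w), which is a contraction for a weighted
   l1 norm because delta > 1 + p.  Hence e and v converge, and their limits
   satisfy the affine fixed point equations up to O(w^(3/2)). *)

(** * The key trigonometric inequality *)

(** The corner of the region of x is the point alpha = 2 a / PI, sigma = x alpha, where psi1 returns
    alpha itself: the regions are anchored on the curve alpha = psi1. Their bound on sigma^2 is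
    linear in alpha because Q is bounded by a multiple of th and the next alpha is 2 th / PI. As x
    grows the corner tends to alpha = 0, sigma = 2 / PI, where Q = 1 - p; comparing (1 - p) / delta
    with sigma^2 = p yields the threshold PI^2 / 4 - 1. The trigonometric inequality becomes an
    equality in this limit, so no crude estimate of it can work. Locally the obstacle is that 1 -
    alpha and sigma are not Lipschitz functions of e and v at (0, 0). The noise keeps the orbit at a
    distance of order h = sqrt w from that point, so the inversion costs a factor 1 / h, and the
    terms that pay it have derivatives of order h^2 in (alpha, sigma). The affine fixed point is e =
    p v, v = w / (1 - (1 + p) / delta), hence e + v = w / (1 / (1 + p) - 1 / delta). All constants
    are uniform in w; only the time of entry into the box may depend on it. *)

Lemma INR_fact_S n : INR (fact (S n)) = INR (S n) * INR (fact n).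
Proof. rewrite fact_simpl, mult_INR. reflexivity. Qed.

(* Unary evaluation of [fact 19] overflows the stack, hence [INR_fact_S]. *)
Ltac eval_trig_approx H :=
  unfold sin_approx, sin_term, cos_approx, cos_term in H;
  cbn [sum_f_R0 Nat.mul Nat.add] in H;
  rewrite ?INR_fact_S in H;
  change (INR (fact 0)) with 1 in H;
  rewrite ?INR_IZR_INZ in H;
  cbn [Z.of_nat Pos.of_succ_nat Pos.succ] in H.

(** The sine changes sign at PI, and its alternating Taylor sums are accurate enough to decide the
    sign at both decimals. *)
Lemma PI_bounds : 3.14159 < PI < 3.1416.
Proof.
  pose proof PI2_3_2. pose proof PI_4.
  split.
  - apply Rnot_le_lt; intro H1.
    assert (H2 : sin 3.14159 <= 0) by (apply sin_le_0; lra).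
    destruct (pre_sin_bound 3.14159 4) as [H3 _]; try lra.
    eval_trig_approx H3.
    pose proof (Rle_trans _ _ _ H3 H2) as H4. clear H3 H2. lra.
  - apply Rnot_le_lt; intro H1.
    assert (H2 : 0 <= sin 3.1416) by (apply sin_ge_0; lra).
    destruct (pre_sin_bound 3.1416 4) as [_ H3]; try lra.
    eval_trig_approx H3.
    pose proof (Rle_trans _ _ _ H2 H3) as H4. clear H3 H2. lra.
Qed.

Lemma sin_lower z : 0 <= z <= 2 ->
  z * (1 - z^2/6 + z^4/120 - z^6/5040 + z^8/362880 - z^10/39916800) <= sin z.
Proof.
  intros [H1 H2]. destruct (pre_sin_bound z 2) as [H3 _]; try lra.
  eval_trig_approx H3. eapply Rle_trans; [|exact H3]. right; field.
Qed.

Lemma cos_lower z : 0 <= z <= 2 ->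
  1 - z^2/2 + z^4/24 - z^6/720 + z^8/40320 - z^10/3628800 <= cos z.
Proof.
  intros [H1 H2]. destruct (pre_cos_bound z 2) as [H3 _]; try lra.
  eval_trig_approx H3. eapply Rle_trans; [|exact H3]. right; field.
Qed.

Lemma cos_upper z : 0 <= z <= 2 -> cos z <= 1 - z^2/2 + z^4/24.
Proof.
  intros [H1 H2]. destruct (pre_cos_bound z 0) as [_ H3]; try lra.
  eval_trig_approx H3. eapply Rle_trans; [exact H3|]. right; field.
Qed.

Lemma key_trig_near_0 z p : 0 <= z <= 2 -> 0.4052 < p < 0.4053 ->
  4 - z^2 + p*z^2 - cos z * (4 + z^2 - 3*p*z^2) - 4*p*z*sin z <= 0.
Proof.
  intros Hz Hp. pose proof (sin_lower z Hz) as Hs. pose proof (cos_lower z Hz) as Hc.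
  set (S := sin z) in *. set (C := cos z) in *. clearbody S C.
  assert (HZ : 0 <= z^2 <= 4) by nra.
  assert (H1 : 0 <= 4 + z^2 - 3*p*z^2) by nra.
  assert (H2 : 0 <= 4*p*z) by nra.
  apply (Rmult_le_compat_r _ _ _ H1) in Hc.
  apply (Rmult_le_compat_l _ _ _ H2) in Hs.
  set (Z := z^2) in *.
  (* After inserting the Taylor polynomials the terms of order 0 and 1 in [Z] cancel. The next
     coefficient 1/3 - 5p/6 is negative because p > 2/5, but only by about 0.004, so the higher
     coefficients need tight bounds up to [Z] = 4. *)
  assert (H4 : Z^2 * ((1/3-5*p/6) + (-13/360+11*p/120)*Z + (13/10080 - p*17/5040)*Z^2
     + (1/907200 - (1-3*p)/40320 - 4*p/362880)*Z^3+ ((1-3*p)/3628800 + 4*p/39916800)*Z^4) <= 0).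
  { assert (Z2 : 0 <= Z^2 <= 4*Z) by nra.
    assert (Z3 : 0 <= Z^3 <= 4*Z^2) by nra.
    assert (Z4 : 0 <= Z^4) by nra.
    assert (A1 : (-13/360+11*p/120)*Z <= 0.00105 * Z) by (apply Rmult_le_compat_r; lra).
    assert (A2 : (13/10080 - p*17/5040)*Z^2 <= (-0.000075)*Z^2) by (apply Rmult_le_compat_r; lra).
    assert (A3 : (1/907200 - (1-3*p)/40320 - 4*p/362880)*Z^3 <= 0.0000025 * Z^3) by (apply Rmult_le_compat_r; lra).
    assert (A4 : ((1-3*p)/3628800 + 4*p/39916800)*Z^4 <= 0*Z^4) by (apply Rmult_le_compat_r; lra).
    rewrite <- (Rmult_0_r (Z^2)). apply Rmult_le_compat_l; lra. }
  assert (E : 4 - Z + p*Z - (1 - Z/2 + z^4/24 - z^6/720 + z^8/40320 - z^10/3628800) * (4 + Z - 3*p*Z)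
    - 4*p*z*(z * (1 - Z/6 + z^4/120 - z^6/5040 + z^8/362880 - z^10/39916800)) = Z^2 * ((1/3-5*p/6) + (-13/360+11*p/120)*Z + (13/10080 - p*17/5040)*Z^2
     + (1/907200 - (1-3*p)/40320 - 4*p/362880)*Z^3+ ((1-3*p)/3628800 + 4*p/39916800)*Z^4)).
  { unfold Z. field. }
  lra.
Qed.

Lemma key_trig_near_PI w : 0 <= w <= 1.15 ->
  let z := PI - w in let p := 4 / PI^2 in
  4 - z^2 + p*z^2 - cos z * (4 + z^2 - 3*p*z^2) - 4*p*z*sin z <= 0.
Proof.
  intros Hw z p. unfold z.
  replace (cos (PI - w)) with (- cos w) by (rewrite cos_minus, cos_PI, sin_PI; ring).
  replace (sin (PI - w)) with (sin w) by (rewrite sin_minus, cos_PI, sin_PI; ring).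
  pose proof PI_bounds as HP. 
  assert (Hs : w - w^3/6 + w^5/120 - w^7/5040 <= sin w).
  { destruct (pre_sin_bound w 1) as [H3 _]; try lra.
    eval_trig_approx H3. eapply Rle_trans; [|exact H3]. right; field. }
  pose proof (cos_upper w ltac:(lra)) as Hc.
  set (S := sin w) in *. set (C := cos w) in *. clearbody S C.
  set (i := / PI).
  assert (Hi : i * PI = 1) by (unfold i; field; lra).
  assert (Hpi : p = 4*i^2) by (unfold p, i; field; lra).
  clearbody i p. subst p. set (P := PI) in *. clearbody P. clear z.
  assert (HI : 0.31830 < i < 0.31832)
    by (split; apply (Rmult_lt_reg_r P); rewrite ?Hi; lra).
  (* Every product i * P is replaced by 1; after that the terms of order 0 and 1 in [w] cancel
     identically, and the coefficient of w^2 is about -0.124. *)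
  replace (4*i^2*(P-w)^2) with (4 - 8*i*w + 4*i^2*w^2) by
    (transitivity (4*(i*P)^2 - 8*i*(i*P)*w + 4*i^2*w^2); [rewrite Hi; ring|ring]).
  replace (3*(4*i^2)*(P-w)^2) with (12 - 24*i*w + 12*i^2*w^2) by
    (transitivity (12*(i*P)^2 - 24*i*(i*P)*w + 12*i^2*w^2); [rewrite Hi; ring|ring]).
  replace (4*(4*i^2)*(P-w)) with (16*i-16*i^2*w) by
    (transitivity (16*i*(i*P) - 16*i^2*w); [rewrite Hi; ring|ring]).
  assert (HP2 : 9.8695 <= P^2 <= 9.8697) by nra.
  assert (Hi2 : 0.1013 <= i^2 <= 0.10134) by nra.
  assert (Hw2 : 0 <= w^2 <= 1.15 * w) by nra.
  assert (Hiw : 0 <= (i - 0.3183) * w) by (apply Rmult_le_pos; lra).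
  assert (HPw : 0 <= (3.1416 - P) * w) by (apply Rmult_le_pos; lra).
  assert (Hiw2 : 0 <= (0.10134 - i^2) * w^2) by (apply Rmult_le_pos; lra).
  assert (Hi2w : 0 <= (0.10134 - i^2) * w) by (apply Rmult_le_pos; lra).
  assert (H1 : 0 <= 4 + (P-w)^2 - (12-24*i*w+12*i^2*w^2)) by lra.
  assert (H2 : 0 <= 16*i-16*i^2*w) by lra.
  apply (Rmult_le_compat_r _ _ _ H1) in Hc.
  apply (Rmult_le_compat_l _ _ _ H2) in Hs.
  assert (H4 : w^2 * ((4+8*i^2-P^2/2) + (P - 28/3*i)*w + (-1/2+10/3*i^2-1/3+P^2/24)*w^2
     + (i-P/12-2/15*i)*w^3 + (1/24 - i^2/2+2/15*i^2)*w^4 + 16*i/5040*w^5 - 16*i^2/5040*w^6) <= 0).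
  { assert (W3 : 0 <= w^3 <= 1.15*w^2) by nra.
    assert (W4 : 0 <= w^4 <= 1.3225 * w^2) by nra.
    assert (W5 : 0 <= w^5 <= 1.521*w^2) by nra.
    assert (W6 : 0 <= w^6) by nra.
    assert (A1 : (P - 28/3*i)*w <= 0.1709 * w) by (apply Rmult_le_compat_r; lra).
    assert (A2 : (-1/2+10/3*i^2-1/3+P^2/24)*w^2 <= (-0.084)*w^2) by (apply Rmult_le_compat_r; lra).
    assert (A3 : (i-P/12-2/15*i)*w^3 <= 0.0142 * w^3) by (apply Rmult_le_compat_r; lra).
    assert (A4 : (1/24 - i^2/2+2/15*i^2)*w^4 <= 0.0051*w^4) by (apply Rmult_le_compat_r; lra).
    assert (A5 : 16*i/5040*w^5 <= 0.00102*w^5) by (apply Rmult_le_compat_r; lra).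
    assert (A6 : 0 <= 16*i^2/5040*w^6) by (apply Rmult_le_pos; lra).
    (* With w^3, w^4, w^5 dominated by multiples of w^2, the nonconstant part is at most 0.1709 w -
       0.059 w^2, which increases on [0, 1.15]; [A7] compares it with its value at 1.15. *)
    assert (A7 : 0 <= (1.15 - w) * (0.1709 - 0.059*(1.15 + w))) by (apply Rmult_le_pos; lra).
    rewrite <- (Rmult_0_r (w^2)). apply Rmult_le_compat_l; lra. }
  assert (E : 4 - (P-w)^2 + (4 - 8*i*w + 4*i^2*w^2) + (1 - w^2/2+w^4/24) * (4 + (P-w)^2 - (12-24*i*w+12*i^2*w^2))
    - (16*i-16*i^2*w)*(w - w^3/6 + w^5/120 - w^7/5040) = w^2 * ((4+8*i^2-P^2/2) + (P - 28/3*i)*w + (-1/2+10/3*i^2-1/3+P^2/24)*w^2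
     + (i-P/12-2/15*i)*w^3 + (1/24 - i^2/2+2/15*i^2)*w^4 + 16*i/5040*w^5 - 16*i^2/5040*w^6)).
  { field. }
  lra.
Qed.

(* In terms of [z = 2 * th] this is the trigonometric inequality above. It vanishes
   to order four at 0 and to order two at PI and is nowhere slacker than about
   0.02, hence the two Taylor expansions. *)
Lemma key_inequality th : 0 < th < PI / 2 ->
  let p := 4 / PI^2 in let c := th * (cos th / sin th) in
  1 - p * th^2 - 2*p*c - (1-2*p)*c^2 <= 0.
Proof.
  intros Hth p c. pose proof PI_bounds as HP.
  assert (Hp : 0.4052 < p < 0.4053).
  { unfold p. split; apply (Rmult_lt_reg_r (PI^2)); try nra;
      replace (4 / PI^2 * PI^2) with 4 by (field; lra); nra. }
  assert (HM : 4 - (2*th)^2 + p*(2*th)^2 - cos (2*th) * (4 + (2*th)^2 - 3*p*(2*th)^2) - 4*p*(2*th)*sin (2*th) <= 0).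
  { destruct (Rle_dec (2*th) 2).
    - apply key_trig_near_0; lra.
    - replace (2*th) with (PI - (PI - 2*th)) by ring. apply key_trig_near_PI; lra. }
  assert (Hs : 0 < sin th) by (apply sin_gt_0; lra).
  pose proof (sin2_cos2 th) as H2. unfold Rsqr in H2.
  rewrite cos_2a, sin_2a in HM.
  apply (Rmult_le_reg_l (8*(sin th)^2)); [nra|].
  replace (8 * sin th ^ 2 * (1 - p * th ^ 2 - 2 * p * c - (1 - 2 * p) * c ^ 2))
    with (8 * (sin th^2 - p*th^2 * sin th^2 - 2*p*th*cos th*sin th - (1-2*p)*th^2*cos th^2))
    by (unfold c; field; lra).
  rewrite Rmult_0_r.
  replace (cos th^2) with (1 - sin th * sin th) by nra.
  replace (cos th * cos th) with (1 - sin th * sin th) in HM by lra.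
  nra.
Qed.

(** * One-step bounds *)

Lemma atan_diff x y : x < y ->
  exists c, atan y - atan x = (y - x) / (1 + c^2) /\ x < c < y.
Proof.
  intros H.
  destruct (MVT_cor2 atan (fun c => / (1 + c^2)) x y H) as [c [Hc1 Hc2]].
  - intros c _. apply derivable_pt_lim_atan.
  - exists c. split; [rewrite Hc1; unfold Rdiv; ring | exact Hc2].
Qed.

Lemma atan_diff_lower x y : 0 <= x <= y -> (y - x) / (1 + y^2) <= atan y - atan x.
Proof.
  intros [H0 [H|H]].
  - destruct (atan_diff x y H) as [c [-> Hc]].
    unfold Rdiv. apply Rmult_le_compat_l; [lra|]. apply Rinv_le_contravar; nra.
  - subst y. right. unfold Rdiv; ring.
Qed.

Lemma atan_diff_upper x y : 0 <= x <= y -> atan y - atan x <= (y - x) / (1 + x^2).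
Proof.
  intros [H0 [H|H]].
  - destruct (atan_diff x y H) as [c [-> Hc]].
    unfold Rdiv. apply Rmult_le_compat_l; [lra|]. apply Rinv_le_contravar; nra.
  - subst y. right. unfold Rdiv; ring.
Qed.

Lemma atan_nondecreasing x y : x <= y -> atan x <= atan y.
Proof. intros [H| ->]; [left; now apply atan_increasing | apply Rle_refl]. Qed.

Lemma atan_pos x : 0 < x -> 0 < atan x.
Proof. intros H. rewrite <- atan_0. now apply atan_increasing. Qed.

Lemma atan_le_id x : 0 <= x -> atan x <= x.
Proof.
  intros H. pose proof (atan_diff_upper 0 x ltac:(lra)) as H1.
  rewrite atan_0 in H1. replace ((x - 0) / (1 + 0^2)) with x in H1 by field. lra.
Qed.

(** Concavity: the mean slope on [0, x] is at least the mean slope on [x, 1]. *)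
Lemma atan_chord x : 0 <= x <= 1 -> PI / 4 * x <= atan x.
Proof.
  intros [[H0| <-] [H1|H1]]; try (subst; rewrite ?atan_0, ?atan_1; lra).
  destruct (atan_diff 0 x H0) as [c [Hc Hc']]. destruct (atan_diff x 1 H1) as [d [Hd Hd']].
  rewrite atan_0 in Hc. rewrite atan_1 in Hd.
  assert (H : / (1 + d^2) <= / (1 + c^2)) by (apply Rinv_le_contravar; nra).
  unfold Rdiv in *. apply (Rmult_le_compat_l (x * (1 - x))) in H; nra.
Qed.

(** * The inverse cotangent *)

Definition acot x := atan (/ x).

Lemma acot_eq x : 0 < x -> acot x = PI / 2 - atan x.
Proof. apply atan_inv. Qed.

Lemma acot_pos x : 0 < x -> 0 < acot x.
Proof. intros H. apply atan_pos. now apply Rinv_0_lt_compat. Qed.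

Lemma acot_lt_PI2 x : 0 < x -> acot x < PI / 2.
Proof. intros H. rewrite acot_eq by lra. pose proof (atan_pos x H). lra. Qed.

Lemma acot_lower x : 0 < x -> x / (1 + x^2) <= acot x.
Proof.
  intros H. pose proof (Rinv_0_lt_compat x H).
  pose proof (atan_diff_lower 0 (/ x) ltac:(lra)) as H1. rewrite atan_0 in H1.
  unfold acot. replace (x / (1 + x^2)) with ((/ x - 0) / (1 + (/ x)^2)).
  - lra.
  - field. nra.
Qed.

Lemma acot_nonincreasing x y : 0 < x <= y -> acot y <= acot x.
Proof.
  intros H. rewrite !acot_eq by lra. pose proof (atan_nondecreasing x y). lra.
Qed.

Lemma acot_surjective b : 0 < b < PI / 2 -> exists x, 0 < x /\ acot x = b.
Proof.
  intros H. exists (tan (PI / 2 - b)).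
  assert (H1 : 0 < tan (PI / 2 - b)) by (apply tan_gt_0; lra).
  split; [exact H1|]. rewrite acot_eq by exact H1. rewrite atan_tan; lra.
Qed.

(** The loss x^2 (acot x - acot y) is at most (y - x) x^2 / (1 + x^2), hence at most (y - x) y^2 /
    (1 + y^2), and y / (1 + y^2) <= acot y makes this at most (y - x) y acot y. *)
Lemma acot_mul_sq_nondecreasing x y : 0 < x <= y -> acot x * x^2 <= acot y * y^2.
Proof.
  intros H. pose proof (atan_diff_upper x y ltac:(lra)) as H1.
  pose proof (acot_lower y ltac:(lra)) as H2.
  assert (H3 : acot x - acot y <= (y - x) / (1 + x^2)) by (rewrite !acot_eq; lra).
  assert (H4 : x^2 / (1 + x^2) <= y^2 / (1 + y^2)).
  { apply (Rmult_le_reg_r ((1 + x^2) * (1 + y^2))); [nra|].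
    replace (x ^ 2 / (1 + x ^ 2) * ((1 + x ^ 2) * (1 + y ^ 2))) with (x^2 * (1+y^2)) by (field; nra).
    replace (y ^ 2 / (1 + y ^ 2) * ((1 + x ^ 2) * (1 + y ^ 2))) with (y^2 * (1+x^2)) by (field; nra).
    nra. }
  assert (H5 : x^2 * (acot x - acot y) <= (y - x) * (y * acot y)).
  { apply Rle_trans with ((y - x) * (x^2 / (1 + x^2))).
    - replace ((y - x) * (x ^ 2 / (1 + x ^ 2))) with (x^2 * ((y - x) / (1 + x^2))) by (field; nra).
      apply Rmult_le_compat_l; nra.
    - apply Rmult_le_compat_l; [lra|]. apply Rle_trans with (1 := H4).
      replace (y^2 / (1 + y^2)) with (y * (y / (1 + y^2))) by (field; nra).
      apply Rmult_le_compat_l; lra. }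
  pose proof (acot_pos y ltac:(lra)).
  assert (0 <= (y - x) * (x * acot y)) by (apply Rmult_le_pos; nra).
  nra.
Qed.

Definition p := 4 / PI^2.

Lemma p_bounds : 0.4052 < p < 0.4053.
Proof.
  pose proof PI_bounds as HP.
  unfold p. split; apply (Rmult_lt_reg_r (PI^2)); try nra;
    replace (4 / PI^2 * PI^2) with 4 by (field; lra); nra.
Qed.

Lemma key_acot x : 0 < x ->
  1 - p * acot x^2 - 2*p*(acot x * x) - (1-2*p)*(acot x * x)^2 <= 0.
Proof.
  intros Hx. pose proof (acot_pos x Hx). pose proof (acot_lt_PI2 x Hx).
  pose proof (key_inequality (acot x) ltac:(lra)) as H1. cbv zeta in H1.
  fold p in H1. replace (cos (acot x) / sin (acot x)) with x in H1; [exact H1|].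
  assert (H2 : 0 < sin (acot x)) by (apply sin_gt_0; lra).
  assert (H3 : tan (acot x) = / x) by (unfold acot; apply tan_atan).
  unfold tan in H3.
  assert (0 < cos (acot x)) by (apply cos_gt_0; lra).
  apply (f_equal Rinv) in H3. rewrite Rinv_inv in H3.
  transitivity (/ (sin (acot x) / cos (acot x))); [now symmetry|field; lra].
Qed.

(** * Upper bounds for Q on a region *)

Definition Q al s := al^2 + s^2 + 1 - 4*s/PI - 4*al/PI*atan (al / s).

(** In these coordinates the angle atan (al / s) = acot t does not involve b, so Q is quadratic in b
    along each ray. The curve alpha = psi1 is b = acot t. *)
Lemma Q_cot b t : 0 < b -> 0 < t ->
  Q (2 / PI * b) (2 / PI * b * t) = p*b^2*(1+t^2) + 1 - 2*p*b*(t + acot t).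
Proof.
  intros Hb Ht. pose proof PI_RGT_0. unfold Q, acot, p.
  replace (2 / PI * b / (2 / PI * b * t)) with (/ t) by (field; lra).
  field. lra.
Qed.

(** For t = T, on the curve alpha = psi1, this is the key inequality. Decreasing t with b = acot T
    fixed changes Q by terms controlled by T - t, and the mean value theorem gives acot t - acot T
    >= (T - t) / (1 + T^2), enough to pay for them on the right. *)
Lemma Q_le_wide T t : 0 < t <= T ->
  Q (2 / PI * acot T) (2 / PI * acot T * t) <= (1-p) * acot t * (acot T * T^2).
Proof.
  intros H. pose proof (acot_pos T ltac:(lra)) as Hb. rewrite Q_cot by lra.
  pose proof p_bounds as Hp. pose proof (key_acot T ltac:(lra)) as HK.
  pose proof (acot_lower T ltac:(lra)) as HL.
  assert (HD : (T - t) / (1 + T^2) <= acot t - acot T).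
  { rewrite !acot_eq by lra. pose proof (atan_diff_lower t T ltac:(lra)). lra. }
  set (b := acot T) in *. set (th := acot t) in *. clearbody b th.
  (* Difference from the diagonal case [t = T]. *)
  assert (HM : p * ((T - t) * (2 - b * (T + t))) <= (th - b) * (2*p + (1-p)*T^2)).
  { set (k := / (1 + T^2)). assert (Hk : k * (1 + T^2) = 1) by (unfold k; field; nra).
    assert (Hk0 : 0 < k) by (apply Rinv_0_lt_compat; nra).
    unfold Rdiv in *. fold k in HL, HD. clearbody k.
    assert (A1 : 2 - b*(T+t) <= k * (2 + T^2)).
    { assert (T*k*(T+t) <= b*(T+t)) by (apply Rmult_le_compat_r; lra).
      assert (0 <= k * (T * t)) by (apply Rmult_le_pos; nra).
      nra. }
    assert (A2 : (T - t) * (2 - b*(T+t)) <= (T - t) * (k * (2 + T^2)))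
      by (apply Rmult_le_compat_l; lra).
    assert (A3 : (T - t) * k * (2 + T^2) <= (th - b) * (2 + T^2))
      by (apply Rmult_le_compat_r; nra).
    assert (A4 : 0 <= th - b) by nra.
    assert (A5 : 0 <= (th - b) * ((1 - 2*p)*T^2)) by (apply Rmult_le_pos; nra).
    nra. }
  assert (HM' : b * (p * ((T - t) * (2 - b * (T + t)))) <= b * ((th - b) * (2*p + (1-p)*T^2)))
    by (apply Rmult_le_compat_l; lra).
  nra.
Qed.

(** This is the condition p (1 + t^2) (acot t) b <= 1 for b = PI al / 2, which bounds b from above
    in the narrow case below. The assumption al <= 1 serves for t <= 1, and al <= 1 / t for t >
    1. *)
Lemma one_plus_sq_mul_acot_le al t : 0 < t -> 0 < al <= 1 -> al * t <= 1 ->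
  2 / PI * al * (1 + t^2) * acot t <= 1.
Proof.
  intros Ht Ha Hat. pose proof PI_bounds as HP.
  apply (Rmult_le_reg_l (PI / 2)); [lra|].
  replace (PI / 2 * (2 / PI * al * (1 + t^2) * acot t)) with (al * ((1 + t^2) * acot t)) by (field; lra).
  pose proof (acot_pos t Ht) as Hp.
  destruct (Rle_dec t 1) as [H1|H1].
  - assert (H2 : (1 + t^2) * acot t <= PI / 2).
    { rewrite acot_eq by lra. pose proof (atan_chord t ltac:(lra)) as H3.
      assert (H4 : PI / 4 * t * (1 + t^2) <= atan t * (1 + t^2)) by (apply Rmult_le_compat_r; nra).
      assert (H5 : 0 <= PI / 4 * (t * (1 - t)^2)) by (apply Rmult_le_pos; [lra|]; apply Rmult_le_pos; nra).
      nra. }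
    assert (0 < (1 + t^2) * acot t) by (apply Rmult_lt_0_compat; nra).
    nra.
  - apply Rnot_le_lt in H1.
    set (y := / t). assert (Hy : y * t = 1) by (unfold y; field; lra).
    assert (Hy0 : 0 < y < 1) by (split; nra).
    assert (H2 : atan y * (1 + y^2) <= PI / 2 * y).
    { destruct (Rle_dec y 0.7) as [H|H].
      - pose proof (atan_le_id y ltac:(lra)).
        apply Rle_trans with (y * (1 + y^2)); [apply Rmult_le_compat_r; nra|].
        nra.
      - pose proof (atan_diff_lower y 1 ltac:(lra)) as H3. rewrite atan_1 in H3.
        assert (H4 : atan y <= PI / 4 - (1 - y) / 2) by lra.
        apply Rle_trans with ((PI / 4 - (1 - y) / 2) * (1 + y^2)); [apply Rmult_le_compat_r; nra|].
        assert (0 <= (1 - y) * ((1 + y^2)/2 - PI/4*(1-y))) by (apply Rmult_le_pos; nra).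
        nra. }
    change (acot t) with (atan y).
    pose proof (atan_pos y ltac:(lra)) as Hat'.
    apply Rle_trans with (y * ((1 + t^2) * atan y)).
    + apply Rmult_le_compat_r; [nra|]. apply (Rmult_le_reg_r t); lra.
    + apply (Rmult_le_reg_r y); [lra|].
      replace (y * ((1 + t ^ 2) * atan y) * y) with (atan y * (y^2 + (y*t)^2)) by ring.
      rewrite Hy. lra.
Qed.

(* As a function of [b], the difference of the two sides is a quadratic that is
   nonpositive at [b = acot t] by the key inequality; the product of its roots
   locates the second root. *)
Lemma Q_le_narrow b t : 0 < t -> acot t <= b -> 2 / PI * b <= 1 -> 2 / PI * b * t <= 1 ->
  Q (2 / PI * b) (2 / PI * b * t) <= (1-p) * acot t * (b * t^2).
Proof.
  intros Ht Hb H1 H2. pose proof PI_bounds as HP. pose proof (acot_pos t Ht) as Hth.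
  assert (Hb0 : 0 < 2 / PI * b) by (apply Rmult_lt_0_compat; [apply Rdiv_lt_0_compat|]; lra).
  pose proof (one_plus_sq_mul_acot_le _ _ Ht (conj Hb0 H1) H2) as HR.
  rewrite Q_cot by lra. pose proof (key_acot t Ht) as HK.
  replace (2 / PI * (2 / PI * b) * (1 + t^2) * acot t) with (p * (1 + t^2) * acot t * b) in HR
    by (unfold p; field; lra).
  pose proof p_bounds as Hp.
  set (th := acot t) in *. clearbody th.
  apply (Rmult_le_reg_l th); [lra|].
  (* Writing f for the difference of the two sides as a function of b, one has th f(b) = b f(th) -
     (b - th) (1 - p (1 + t^2) th b); [H4] is b f(th) <= 0. *)
  assert (H3 : 0 <= (b - th) * (1 - p * (1 + t^2) * th * b)) by (apply Rmult_le_pos; lra).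
  assert (H4 : b * (1 - p * th ^ 2 - 2 * p * (th * t) - (1 - 2 * p) * (th * t) ^ 2) <= b * 0)
    by (apply Rmult_le_compat_l; lra).
  nra.
Qed.

(* The nested regions of the global argument: the map sends [region x] into
   itself, and x shrinks geometrically along the noiseless orbit. *)
Definition region x al v := 2 / PI * acot x <= al /\ v <= 2 / PI * acot x * x^2 * al.

(** With b = PI al / 2 and t = s / al, the two cases are the two sides of the curve alpha = psi1. If
    acot t <= b, the narrow bound applies and b t^2 <= (acot x) x^2 is the second condition of the
    region. Otherwise b = acot T with t <= T <= x, and the wide bound at T is weakened to x by
    monotonicity of (acot x) x^2. *)
Lemma Q_le_region x al s : 0 < x -> 0 < al < 1 -> 0 < s <= 1 -> region x al (s^2) ->
  acot x <= atan (al / s) /\ Q al s <= (1-p) * atan (al / s) * (acot x * x^2).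
Proof.
  intros Hx Ha Hs [R1 R2]. pose proof PI_bounds as HP. pose proof p_bounds as Hp.
  pose proof (acot_pos x Hx) as Hax.
  set (t := s / al). assert (Ht : 0 < t) by (apply Rdiv_lt_0_compat; lra).
  assert (Et : s = al * t) by (unfold t; field; lra).
  assert (Eth : atan (al / s) = acot t) by (unfold acot, t; f_equal; field; lra).
  rewrite Eth. clearbody t. subst s.
  set (b := PI / 2 * al). assert (Eb : al = 2 / PI * b) by (unfold b; field; lra).
  assert (Hb : 0 < b < PI / 2) by (unfold b; nra).
  assert (Hab : acot x <= b).
  { apply (Rmult_le_reg_l (2 / PI)); [apply Rdiv_lt_0_compat; lra|]. lra. }
  assert (Hbt : b * t^2 <= acot x * x^2).
  { apply (Rmult_le_reg_l (2 / PI * al)).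
    - apply Rmult_lt_0_compat; [apply Rdiv_lt_0_compat|]; lra.
    - replace (2 / PI * al * (b * t^2)) with ((al*t)^2) by (unfold b; field; lra). lra. }
  clearbody b. subst al.
  assert (Htx : t <= x).
  { apply Rnot_lt_le; intro. assert (acot x * x^2 < b * t^2); [|lra].
    apply Rle_lt_trans with (b * x^2); [apply Rmult_le_compat_r; nra|].
    apply Rmult_lt_compat_l; nra. }
  assert (Hac : acot x <= acot t) by (apply acot_nonincreasing; lra).
  split; [exact Hac|].
  assert (Hc : 0 <= (1-p) * acot t) by (apply Rmult_le_pos; lra).
  destruct (Rle_dec (acot t) b) as [H|H].
  - apply Rle_trans with (1 := Q_le_narrow b t Ht H ltac:(lra) ltac:(lra)).
    apply Rmult_le_compat_l; lra.
  - apply Rnot_le_lt in H. destruct (acot_surjective b Hb) as [T [HT <-]].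
    assert (HtT : t <= T).
    { apply Rnot_lt_le; intro. pose proof (acot_nonincreasing T t ltac:(lra)). lra. }
    assert (HTx : T <= x).
    { apply Rnot_lt_le; intro H3.
      pose proof (atan_increasing x T H3). rewrite !acot_eq in Hab by lra. lra. }
    apply Rle_trans with (1 := Q_le_wide T t ltac:(lra)).
    apply Rmult_le_compat_l; [exact Hc|]. apply acot_mul_sq_nondecreasing; lra.
Qed.

(** * Crude bounds for Q *)

Lemma Q_nonneg al s : 0 < al -> 0 < s -> 0 <= Q al s.
Proof.
  intros Ha Hs. pose proof PI_bounds as HP. unfold Q.
  set (th := atan (al / s)).
  assert (Hth : 0 < th < PI / 2).
  { split; [apply atan_pos; now apply Rdiv_lt_0_compat|]. unfold th. pose proof (atan_bound (al / s)). lra. }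
  assert (Htan : tan th = al / s) by apply tan_atan.
  assert (Hc : 0 < cos th) by (apply cos_gt_0; lra).
  (* In polar coordinates Q = r^2 + 1 - (4 / PI) r (cos th + th sin th). Since cos th <= PI / 2 -
     th, the bracket is at most PI / 2, so Q >= (r - 1)^2. *)
  set (r := s / cos th).
  assert (Es : s = r * cos th) by (unfold r; field; lra).
  assert (Ea : al = r * sin th).
  { unfold tan in Htan. unfold r. replace al with (s * (al / s)) by (field; lra).
    rewrite <- Htan. field. lra. }
  assert (Hr : 0 < r) by (apply Rdiv_lt_0_compat; lra).
  assert (Hh : cos th + th * sin th <= PI / 2).
  { assert (cos th <= PI / 2 - th).
    { rewrite <- sin_shift. left. apply sin_lt_x. lra. }
    pose proof (SIN_bound th). nra. }
  assert (E : al^2 + s^2 = r^2).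
  { rewrite Ea, Es. pose proof (sin2_cos2 th) as H. unfold Rsqr in H. nra. }
  assert (E2 : 4*s/PI + 4*al/PI*th <= 2 * r).
  { replace (4*s/PI + 4*al/PI*th) with (4 / PI * (r * (cos th + th * sin th)))
      by (rewrite Ea, Es at 1; field; lra).
    replace (2 * r) with (4 / PI * (r * (PI / 2))) by (field; lra).
    apply Rmult_le_compat_l; [left; apply Rdiv_lt_0_compat; lra|].
    apply Rmult_le_compat_l; lra. }
  pose proof (pow2_ge_0 (r - 1)). lra.
Qed.

(** The chord bound atan (al / s) >= atan al >= PI al / 4 cancels al^2, and 4 s / PI absorbs s^2. *)
Lemma Q_le_1 al s : 0 < al <= 1 -> 0 < s <= 1 -> Q al s <= 1.
Proof.
  intros Ha Hs. pose proof PI_bounds as HP. unfold Q.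
  assert (H : PI / 4 * al <= atan (al / s)).
  { apply Rle_trans with (atan al); [apply atan_chord; lra|]. apply atan_nondecreasing.
    apply (Rmult_le_reg_r s); [lra|]. replace (al / s * s) with al by (field; lra). nra. }
  assert (H1 : 4*al/PI * (PI / 4 * al) <= 4*al/PI*atan (al / s)).
  { apply Rmult_le_compat_l; [left; apply Rdiv_lt_0_compat; lra|exact H]. }
  replace (4*al/PI * (PI / 4 * al)) with (al^2) in H1 by (field; lra).
  assert (H2 : s^2 <= 4*s/PI).
  { apply (Rmult_le_reg_r PI); [lra|]. replace (4*s/PI*PI) with (4*s) by (field; lra). nra. }
  lra.
Qed.

Lemma Q_le_sq al s : 0 < al <= 1 -> 1 <= s -> Q al s <= s^2.
Proof.
  intros Ha Hs. pose proof PI_bounds as HP. unfold Q.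
  assert (Hu : al / s <= al).
  { apply (Rmult_le_reg_r s); [lra|]. replace (al / s * s) with al by (field; lra). nra. }
  assert (Hu0 : 0 < al / s) by (apply Rdiv_lt_0_compat; lra).
  pose proof (atan_diff_upper (al / s) al ltac:(lra)) as H.
  assert (H1 : atan al - atan (al / s) <= al - al / s).
  { apply Rle_trans with (1 := H). unfold Rdiv at 1.
    rewrite <- (Rmult_1_r (al - al / s)) at 2. apply Rmult_le_compat_l; [lra|].
    rewrite <- Rinv_1. apply Rinv_le_contravar; nra. }
  pose proof (atan_chord al ltac:(lra)) as H2.
  assert (H3 : al - al / s <= s - 1).
  { apply (Rmult_le_reg_r s); [lra|]. replace ((al - al / s) * s) with (al * (s - 1)) by (field; lra). nra. }
  assert (H4 : 1 + PI / 4 * al^2 <= s + al * atan (al / s)) by nra.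
  assert (H5 : 4 / PI * (1 + PI / 4 * al^2) <= 4 / PI * (s + al * atan (al / s)))
    by (apply Rmult_le_compat_l; [left; apply Rdiv_lt_0_compat; lra|exact H4]).
  replace (4 / PI * (1 + PI / 4 * al^2)) with (4 / PI + al^2) in H5 by (field; lra).
  replace (4 / PI * (s + al * atan (al / s))) with (4*s/PI + 4*al/PI*atan (al / s)) in H5 by (field; lra).
  assert (1 <= 4 / PI) by (apply (Rmult_le_reg_r PI); [lra|]; replace (4 / PI * PI) with 4 by (field; lra); lra).
  lra.
Qed.

(** * Global convergence *)

(* Orbits in the coordinates (alpha, sigma), started after the first iteration,
   where sigma is positive. *)
Definition orbit delta w (al s : nat -> R) :=
  0 < al 0%nat <= 1 /\ w <= s 0%nat ^ 2 /\ (forall n, 0 < s n) /\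
  forall n, al (S n) = 2 / PI * atan (al n / s n) /\
            s (S n) ^ 2 = Q (al n) (s n) / delta + w.

(** Strict inequality starts at index 1: with sigma_0^2 = 0 and positive alpha_0, the first iterate
    of alpha, which is index 0 here, equals 1. *)
Lemma orbit_al_bounds delta w al s : orbit delta w al s ->
  forall n, 0 < al n <= 1 /\ al (S n) < 1.
Proof.
  intros [H0 [_ [Hs H]]]. pose proof PI_bounds.
  assert (Hstep : forall n, 0 < al n -> 0 < al (S n) < 1).
  { intros n Hn. destruct (H n) as [-> _]. specialize (Hs n).
    pose proof (atan_pos (al n / s n) ltac:(now apply Rdiv_lt_0_compat)).
    pose proof (atan_bound (al n / s n)).
    assert (0 < 2 / PI) by (apply Rdiv_lt_0_compat; lra).
    split; [now apply Rmult_lt_0_compat|].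
    replace 1 with (2 / PI * (PI / 2)) by (field; lra). apply Rmult_lt_compat_l; lra. }
  assert (Hpos : forall n, 0 < al n <= 1).
  { induction n as [|n IH]; [exact H0|]. specialize (Hstep n ltac:(lra)). lra. }
  intros n. split; [apply Hpos|]. apply Hstep. apply Hpos.
Qed.

Lemma orbit_s_lower delta w al s : 0 < delta -> orbit delta w al s ->
  forall n, w <= s n ^ 2.
Proof.
  intros Hd Ho. pose proof (orbit_al_bounds _ _ _ _ Ho) as Ha.
  destruct Ho as [_ [H0 [Hs H]]]. intros [|n]; [exact H0|].
  destruct (H n) as [_ ->]. pose proof (Q_nonneg (al n) (s n) ltac:(apply Ha) (Hs n)).
  assert (0 <= Q (al n) (s n) / delta) by (apply Rmult_le_pos; [|left; apply Rinv_0_lt_compat]; lra).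
  lra.
Qed.

Lemma delta_lower delta : delta > PI^2 / 4 - 1 -> 1.467 < delta.
Proof. pose proof PI_bounds. nra. Qed.

Lemma orbit_s_step delta w al s : delta > PI^2 / 4 - 1 -> w <= 0.01 -> orbit delta w al s ->
  forall n, (s n <= 1 -> s (S n) ^ 2 <= 0.7) /\ (1 <= s n -> s (S n) ^ 2 <= 0.7 * s n ^ 2).
Proof.
  intros Hd Hw Ho n. apply delta_lower in Hd.
  destruct (orbit_al_bounds _ _ _ _ Ho n) as [Ha _].
  destruct Ho as [_ [H0 [Hs H]]]. destruct (H n) as [_ ->]. specialize (Hs n).
  (* 0.682 exceeds 1 / 1.467, and adding the noise bound 0.01 keeps the sum below 0.7. *)
  assert (Hi : 0 < / delta <= 0.682).
  { split; [apply Rinv_0_lt_compat; lra|]. apply (Rmult_le_reg_r delta); [lra|].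
    rewrite Rinv_l by lra. lra. }
  unfold Rdiv. split; intros.
  - pose proof (Q_le_1 (al n) (s n) Ha ltac:(lra)).
    assert (Q (al n) (s n) * / delta <= 1 * / delta) by (apply Rmult_le_compat_r; lra). lra.
  - pose proof (Q_le_sq (al n) (s n) Ha ltac:(lra)).
    assert (Q (al n) (s n) * / delta <= s n ^ 2 * / delta) by (apply Rmult_le_compat_r; lra). nra.
Qed.

Lemma orbit_s_geometric delta w al s M : delta > PI^2 / 4 - 1 -> w <= 0.01 ->
  orbit delta w al s -> s 0%nat ^ 2 <= M ->
  forall n, s n <= 1 \/ s n ^ 2 <= 0.7 ^ n * M.
Proof.
  intros Hd Hw Ho HM.
  pose proof (orbit_s_step _ _ _ _ Hd Hw Ho) as Hstep.
  destruct Ho as [_ [_ [Hs _]]].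
  induction n as [|n IH].
  - right. simpl. simpl in HM. lra.
  - destruct (Hstep n) as [H1 H2]. pose proof (Hs n). pose proof (Hs (S n)).
    destruct (Rle_dec (s n) 1) as [H3|H3].
    + left. specialize (H1 H3). nra.
    + right. destruct IH as [IH|IH]; [lra|].
      specialize (H2 ltac:(lra)). simpl pow at 2. nra.
Qed.

(** The time T is chosen before w and the orbit, so that a lower bound for alpha at a fixed time is
    enough afterwards. *)
Lemma orbit_s_eventually_le_1 delta M : delta > PI^2 / 4 - 1 ->
  exists T, forall w al s, w <= 0.01 -> orbit delta w al s -> s 0%nat ^ 2 <= M ->
  forall n, (T <= n)%nat -> s n <= 1.
Proof.
  intros Hd.
  assert (HM : 0 < / (1 + Rabs M)) by (apply Rinv_0_lt_compat; pose proof (Rabs_pos M); lra).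
  destruct (pow_lt_1_zero 0.7 ltac:(rewrite Rabs_pos_eq; lra) _ HM) as [T HT].
  exists T. intros w al s Hw Ho H0 n Hn.
  destruct (orbit_s_geometric _ _ _ _ _ Hd Hw Ho H0 n) as [H|H]; [exact H|].
  specialize (HT n Hn). pose proof (Rle_abs (0.7^n)) as H1. pose proof (Rle_abs M) as H2.
  pose proof (Rabs_pos M). pose proof (pow_lt 0.7 n ltac:(lra)) as H4.
  assert (0.7^n * (1 + Rabs M) < 1).
  { replace 1 with (/ (1 + Rabs M) * (1 + Rabs M)) at 2 by (field; lra). apply Rmult_lt_compat_r; lra. }
  assert (0.7^n * M <= 0.7^n * (1 + Rabs M)) by (apply Rmult_le_compat_l; lra).
  destruct Ho as [_ [_ [Hs _]]]. specialize (Hs n). nra.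
Qed.

(** Since sigma stays below B, one step cannot bring alpha arbitrarily close to 0. The bound
    degrades with n but not with w, which makes the initial region uniform in w. *)
Lemma orbit_al_lower delta M l0 n : delta > PI^2 / 4 - 1 -> 0 < l0 ->
  exists l, 0 < l /\ forall w al s, w <= 0.01 -> orbit delta w al s ->
    s 0%nat ^ 2 <= M -> l0 <= al 0%nat -> l <= al n.
Proof.
  intros Hd Hl0. pose proof PI_bounds as HP.
  set (B := 1 + Rabs M). assert (HB : 1 <= B) by (unfold B; pose proof (Rabs_pos M); lra).
  induction n as [|n [l [Hl IH]]].
  - exists l0. split; [exact Hl0|]. auto.
  - exists (2 / PI * atan (l / B)). split.
    + apply Rmult_lt_0_compat; [apply Rdiv_lt_0_compat; lra|]. apply atan_pos.
      apply Rdiv_lt_0_compat; lra.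
    + intros w al s Hw Ho HM Ha. specialize (IH w al s Hw Ho HM Ha).
      assert (HsB : s n <= B).
      { destruct (orbit_s_geometric _ _ _ _ _ Hd Hw Ho HM n) as [H|H]; [lra|].
        pose proof (Rle_abs M). pose proof (Rabs_pos M).
        assert (0 < 0.7^n <= 1).
        { split; [apply pow_lt; lra|]. rewrite <- (pow1 n). apply pow_incr. lra. }
        assert (0.7 ^ n * M <= Rabs M) by nra.
        apply Rnot_lt_le; intro. unfold B in *. nra. }
      destruct Ho as [_ [_ [Hs H]]]. destruct (H n) as [-> _]. specialize (Hs n).
      apply Rmult_le_compat_l; [left; apply Rdiv_lt_0_compat; lra|].
      apply atan_nondecreasing. unfold Rdiv. apply Rmult_le_compat; try lra.
      * left; apply Rinv_0_lt_compat; lra.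
      * apply Rinv_le_contravar; lra.
Qed.

(** With x = 4 / l, acot x <= l / 4 gives the first condition; (acot x) x^2 >= x / 2 makes the bound
    on v at least 4 / PI. *)
Lemma region_start l al v : 0 < l <= al -> al <= 1 -> v <= 1 -> region (4 / l) al v.
Proof.
  intros Hl Ha Hv. pose proof PI_bounds as HP.
  assert (H0 : 4 <= 4 / l).
  { apply (Rmult_le_reg_r l); [lra|]. replace (4 / l * l) with 4 by (field; lra). lra. }
  set (x := 4 / l) in *.
  assert (Hx : x * l = 4) by (unfold x; field; lra).
  assert (H1 : acot x <= l / 4).
  { unfold acot. replace (/ x) with (l / 4) by (unfold x; field; lra). apply atan_le_id. lra. }
  pose proof (acot_lower x ltac:(lra)) as H2. pose proof (acot_pos x ltac:(lra)) as H3.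
  clearbody x.
  assert (H4 : 2 / PI < 1).
  { apply (Rmult_lt_reg_r PI); [lra|]. replace (2 / PI * PI) with 2 by (field; lra). lra. }
  assert (H4' : 0.6 < 2 / PI).
  { apply (Rmult_lt_reg_r PI); [lra|]. replace (2 / PI * PI) with 2 by (field; lra). lra. }
  split; [nra|].
  assert (H5 : x / 2 <= acot x * x^2).
  { apply Rle_trans with (x / (1 + x^2) * x^2); [|apply Rmult_le_compat_r; nra].
    apply (Rmult_le_reg_r (1 + x^2)); [nra|].
    replace (x / (1 + x^2) * x^2 * (1 + x^2)) with (x^3) by (field; nra). nra. }
  assert (H6 : 2 <= acot x * x^2 * al).
  { apply Rle_trans with (x / 2 * al); [nra|]. apply Rmult_le_compat_r; lra. }
  nra.
Qed.

(** * Contraction of the nested regions *)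

Definition contraction_rate delta := (PI^2 / 4 - 1) / delta.

Lemma contraction_rate_bounds delta : delta > PI^2 / 4 - 1 -> 0 < contraction_rate delta < 1.
Proof.
  intros Hd. pose proof PI_bounds. unfold contraction_rate. split.
  - apply Rdiv_lt_0_compat; nra.
  - apply (Rmult_lt_reg_r delta); [nra|].
    replace ((PI^2/4-1) / delta * delta) with (PI^2/4-1) by (field; nra). lra.
Qed.

(** The rate is (1 - p) / (p delta), the factor left when the bound on Q / delta is compared with
    the region's bound at the new alpha = 2 th / PI. The gap between [lam] and the rate is spent on
    the noise, where th >= acot x makes the allowance independent of the point. *)
Lemma region_step delta w lam x al s :
  delta > PI^2 / 4 - 1 -> contraction_rate delta < lam < 1 -> 0 < x ->
  0 < al < 1 -> 0 < s <= 1 -> region x al (s^2) ->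
  w <= (lam - contraction_rate delta) * p * (acot x * x)^2 ->
  2 / PI * acot x <= 2 / PI * atan (al / s) /\
  Q al s / delta + w <= lam * (2 / PI * acot x * x^2 * (2 / PI * atan (al / s))).
Proof.
  intros Hd Hlam Hx Ha Hs HR Hw. pose proof PI_bounds as HP.
  pose proof (delta_lower _ Hd) as Hd'.
  destruct (Q_le_region x al s Hx Ha Hs HR) as [H1 H2].
  split; [apply Rmult_le_compat_l; [left; apply Rdiv_lt_0_compat; lra|exact H1]|].
  pose proof (acot_pos x Hx) as Hax. pose proof p_bounds as Hp.
  set (th := atan (al / s)) in *. clearbody th.
  apply (Rmult_le_compat_r (/ delta)) in H2; [|left; apply Rinv_0_lt_compat; lra].
  replace ((1 - p) * th * (acot x * x^2) * / delta)
    with (contraction_rate delta * (p * (th * (acot x * x^2)))) in H2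
    by (unfold contraction_rate, p; field; lra).
  replace (lam * (2 / PI * acot x * x^2 * (2 / PI * th))) with (lam * (p * (th * (acot x * x^2))))
    by (unfold p; field; lra).
  assert (H3 : (lam - contraction_rate delta) * p * (acot x * x)^2
     <= (lam - contraction_rate delta) * (p * (th * (acot x * x^2)))).
  { rewrite Rmult_assoc. apply Rmult_le_compat_l; [lra|]. apply Rmult_le_compat_l; [lra|].
    replace ((acot x * x)^2) with (acot x * (acot x * x^2)) by ring.
    apply Rmult_le_compat_r; [|exact H1]. apply Rmult_le_pos; nra. }
  unfold Rdiv. lra.
Qed.

(* From [s^2 <= lam K al] the angle improves to [acot (sqrt lam x)], and this
   single replacement absorbs the factor [lam] in the second condition too. *)
Lemma region_gain mu x al s : 0 < mu < 1 -> 0 < x -> 0 < al -> 0 < s ->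
  2 / PI * acot x <= al -> s^2 <= mu^2 * (2 / PI * acot x * x^2 * al) ->
  acot (mu * x) <= atan (al / s).
Proof.
  intros Hmu Hx Ha Hs H1 H2. pose proof PI_bounds as HP.
  unfold acot. apply atan_nondecreasing.
  assert (Hmx : 0 < mu * x) by nra.
  apply (Rmult_le_reg_r (s * (mu * x))); [nra|].
  replace (/ (mu * x) * (s * (mu * x))) with s by (field; lra).
  replace (al / s * (s * (mu * x))) with (al * (mu * x)) by (field; lra).
  apply Rsqr_incr_0; try nra. unfold Rsqr.
  apply Rle_trans with (mu^2 * (x^2 * (al * al))); [|right; ring].
  replace (s * s) with (s^2) by ring. apply Rle_trans with (1 := H2).
  apply Rmult_le_compat_l; [nra|].
  replace (2 / PI * acot x * x^2 * al) with (x^2 * (2 / PI * acot x * al)) by ring.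
  apply Rmult_le_compat_l; [nra|]. apply Rmult_le_compat_r; lra.
Qed.

(** One step gains the factor mu^2 in the bound on sigma^2; the next converts it into a larger
    alpha, whence the delay [S (S T)]. The assumption 1 <= T ensures [al T] < 1. *)
Lemma orbit_region_shrinks delta w mu x al s T :
  delta > PI^2 / 4 - 1 -> 0 < mu < 1 -> contraction_rate delta < mu^2 -> 0 < x ->
  w <= 0.01 -> orbit delta w al s -> (1 <= T)%nat -> (forall n, (T <= n)%nat -> s n <= 1) ->
  w <= (mu^2 - contraction_rate delta) * p * (acot x * x)^2 ->
  region x (al T) (s T ^ 2) ->
  (forall n, (T <= n)%nat -> region x (al n) (s n ^ 2)) /\
  (forall n, (S (S T) <= n)%nat -> region (mu * x) (al n) (s n ^ 2)).
Proof.
  intros Hd Hmu Hlam Hx Hw Ho HT Hs1 Hw2 HR. pose proof PI_bounds as HP.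
  pose proof (orbit_al_bounds _ _ _ _ Ho) as Ha.
  assert (Ha1 : forall n, (T <= n)%nat -> 0 < al n < 1).
  { intros n Hn. destruct n as [|n]; [lia|].
    destruct (Ha n) as [_ H]. destruct (Ha (S n)) as [H' _]. lra. }
  destruct Ho as [_ [_ [Hs H]]].
  assert (Hlam' : mu^2 < 1) by nra.
  assert (Hax : 0 < acot x) by now apply acot_pos.
  assert (H2P : 0 < 2 / PI) by (apply Rdiv_lt_0_compat; lra).
  assert (Hstep : forall n, (T <= n)%nat -> region x (al n) (s n ^ 2) ->
    2 / PI * acot x <= al (S n) /\
    s (S n) ^ 2 <= mu^2 * (2 / PI * acot x * x^2 * al (S n))).
  { intros n Hn HRn. destruct (H n) as [-> ->].
    apply region_step; auto. }
  assert (Hreg : forall n, (T <= n)%nat -> region x (al n) (s n ^ 2)).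
  { intros n Hn. induction Hn as [|n Hn IH]; [exact HR|].
    destruct (Hstep n Hn IH) as [H1 H2]. split; [exact H1|].
    apply Rle_trans with (1 := H2).
    assert (0 <= 2 / PI * acot x * x^2 * al (S n)).
    { repeat apply Rmult_le_pos; try lra; destruct (Ha1 (S n) ltac:(lia)); nra. }
    nra. }
  split; [exact Hreg|].
  intros n Hn. destruct n as [|[|n]]; try lia.
  destruct (Hstep n ltac:(lia) (Hreg n ltac:(lia))) as [H1 H2].
  destruct (Hstep (S n) ltac:(lia) (Hreg (S n) ltac:(lia))) as [_ H3].
  pose proof (Ha1 (S n) ltac:(lia)). pose proof (Ha1 (S (S n)) ltac:(lia)).
  split.
  - destruct (H (S n)) as [-> _]. apply Rmult_le_compat_l; [lra|].
    apply region_gain; auto; lra.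
  - apply Rle_trans with (1 := H3).
    replace (2 / PI * acot (mu * x) * (mu * x)^2 * al (S (S n)))
      with (mu^2 * (2 / PI * x^2 * al (S (S n)) * acot (mu * x))) by ring.
    replace (2 / PI * acot x * x^2 * al (S (S n)))
      with (2 / PI * x^2 * al (S (S n)) * acot x) by ring.
    apply Rmult_le_compat_l; [nra|]. apply Rmult_le_compat_l.
    + apply Rmult_le_pos; [apply Rmult_le_pos|]; nra.
    + apply acot_nonincreasing. nra.
Qed.

(** Replacing acot (mu^k x) by its lower bound acot x makes the noise condition purely quadratic in
    mu^k x, so the shrinking can go on until (mu^k x)^2 is of order w. *)
Lemma orbit_region_iter delta w mu x al s T :
  delta > PI^2 / 4 - 1 -> 0 < mu < 1 -> contraction_rate delta < mu^2 -> 0 < x ->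
  w <= 0.01 -> orbit delta w al s -> (1 <= T)%nat -> (forall n, (T <= n)%nat -> s n <= 1) ->
  region x (al T) (s T ^ 2) ->
  forall k, w <= (mu^2 - contraction_rate delta) * p * acot x^2 * (mu^k * x)^2 ->
  exists T', forall n, (T' <= n)%nat -> region (mu^k * x) (al n) (s n ^ 2).
Proof.
  intros Hd Hmu Hlam Hx Hw Ho HT Hs1 HR. pose proof p_bounds as Hp.
  pose proof (acot_pos x Hx) as Hax.
  set (c := (mu^2 - contraction_rate delta) * p * acot x^2).
  assert (Hc : 0 < c) by (unfold c; apply Rmult_lt_0_compat; nra).
  assert (Hmk : forall k, 0 < mu^k <= 1).
  { intros k. split; [apply pow_lt; lra|]. rewrite <- (pow1 k). apply pow_incr; lra. }
  assert (Hcond : forall k, w <= c * (mu^k * x)^2 ->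
    w <= (mu^2 - contraction_rate delta) * p * (acot (mu^k * x) * (mu^k * x))^2).
  { intros k Hk. apply Rle_trans with (1 := Hk). unfold c. rewrite !Rmult_assoc.
    apply Rmult_le_compat_l; [lra|]. apply Rmult_le_compat_l; [lra|].
    rewrite (Rpow_mult_distr (acot (mu^k * x))). apply Rmult_le_compat_r; [nra|].
    apply pow_incr. specialize (Hmk k). split; [lra|]. apply acot_nonincreasing. nra. }
  assert (Hall : forall k, w <= c * (mu^k * x)^2 -> exists T', (T <= T')%nat /\
    forall n, (T' <= n)%nat -> region (mu^k * x) (al n) (s n ^ 2)).
  { induction k as [|k IH]; intros Hk.
    - exists T. split; [lia|].
      replace (mu^0 * x) with x by (simpl; ring).
      apply (orbit_region_shrinks delta w mu x al s T); auto.
      specialize (Hcond 0%nat Hk). replace (mu^0 * x) with x in Hcond by (simpl; ring). exact Hcond.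
    - assert (Hk' : w <= c * (mu^k * x)^2).
      { apply Rle_trans with (1 := Hk). apply Rmult_le_compat_l; [lra|].
        apply pow_incr. destruct (Hmk k) as [Hmk0 _].
        assert (0 < mu^k * x) by nra.
        replace (mu^S k * x) with (mu * (mu^k * x)) by (simpl; ring). split; nra. }
      destruct (IH Hk') as [T' [HT' HR']].
      exists (S (S T')). split; [lia|].
      replace (mu^S k * x) with (mu * (mu^k * x)) by (simpl; ring).
      specialize (Hmk k).
      apply (orbit_region_shrinks delta w mu (mu^k * x) al s T'); auto; try lia.
      + nra.
      + intros n Hn. apply Hs1. lia. }
  intros k Hk. destruct (Hall k Hk) as [T' [_ H]]. now exists T'.
Qed.

Lemma region_bounds x al v : 0 < x -> al <= 1 -> region x al v ->
  1 - al <= x /\ v <= x^2.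
Proof.
  intros Hx Ha [H1 H2]. pose proof PI_bounds as HP.
  pose proof (acot_pos x Hx) as Hax. pose proof (acot_lt_PI2 x Hx) as Hax2.
  pose proof (atan_le_id x ltac:(lra)) as H3. pose proof (atan_pos x Hx) as H3'.
  assert (H4 : 2 / PI < 1).
  { apply (Rmult_lt_reg_r PI); [lra|]. replace (2 / PI * PI) with 2 by (field; lra). lra. }
  assert (H4' : 0 < 2 / PI) by (apply Rdiv_lt_0_compat; lra).
  assert (H5 : 2 / PI * acot x < 1).
  { replace 1 with (2 / PI * (PI / 2)) by (field; lra). apply Rmult_lt_compat_l; lra. }
  split.
  - rewrite acot_eq in H1 by lra.
    replace (2 / PI * (PI / 2 - atan x)) with (1 - 2 / PI * atan x) in H1 by (field; lra). nra.
  - apply Rle_trans with (1 := H2).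
    assert (0 < 2 / PI * acot x) by (apply Rmult_lt_0_compat; lra).
    assert (2 / PI * acot x * al <= 1) by nra.
    replace (2 / PI * acot x * x^2 * al) with (2 / PI * acot x * al * x^2) by ring.
    rewrite <- (Rmult_1_l (x^2)) at 2. apply Rmult_le_compat_r; nra.
Qed.

Lemma orbit_eventually_small delta M l0 : delta > PI^2 / 4 - 1 -> 0 < l0 ->
  exists C eta, 0 < C /\ 0 < eta /\ forall w al s, 0 < w < eta -> orbit delta w al s ->
    s 0%nat ^ 2 <= M -> l0 <= al 0%nat ->
    exists T, forall n, (T <= n)%nat -> 1 - al n <= C * sqrt w /\ s n <= C * sqrt w.
Proof.
  intros Hd Hl0. pose proof p_bounds as Hp.
  destruct (orbit_s_eventually_le_1 delta M Hd) as [T0 HT0].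
  destruct (orbit_al_lower delta M l0 (S T0) Hd Hl0) as [l [Hl Hal]].
  pose proof (contraction_rate_bounds delta Hd) as Hk.
  set (kap := contraction_rate delta) in *.
  assert (Hmu : exists mu, 0 < mu < 1 /\ kap < mu^2).
  { exists ((1 + kap) / 2). split; nra. }
  destruct Hmu as [mu [Hmu Hmuk]].
  set (x := 4 / l). assert (Hx : 0 < x) by (apply Rdiv_lt_0_compat; lra).
  pose proof (acot_pos x Hx) as Hax.
  set (c := (mu^2 - kap) * p * acot x^2).
  assert (Hc : 0 < c) by (unfold c; apply Rmult_lt_0_compat; nra).
  exists (/ (sqrt c * mu)), (Rmin 0.01 (c * x^2)).
  assert (Hsc : 0 < sqrt c) by now apply sqrt_lt_R0.
  split; [apply Rinv_0_lt_compat; nra|].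
  split; [apply Rmin_glb_lt; [lra|apply Rmult_lt_0_compat; nra]|].
  intros w al s Hw Ho HM H0.
  assert (Hw1 : w <= 0.01) by (pose proof (Rmin_l 0.01 (c * x^2)); lra).
  assert (Hw2 : w < c * x^2) by (pose proof (Rmin_r 0.01 (c * x^2)); lra).
  assert (Hs1 : forall n, (S T0 <= n)%nat -> s n <= 1).
  { intros n Hn. apply (HT0 w al s); auto. lia. }
  pose proof (orbit_al_bounds _ _ _ _ Ho) as Ha.
  assert (HR : region x (al (S T0)) (s (S T0) ^ 2)).
  { apply region_start.
    - split; [exact Hl|]. now apply (Hal w al s).
    - apply Ha.
    - specialize (Hs1 (S T0) ltac:(lia)).
      assert (0 < s (S T0)) by (destruct Ho as [_ [_ [Hs _]]]; apply Hs). nra. }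
  (* The last admissible k: the first inequality permits k shrinkings, and the failure at S k gives
     mu^k x <= sqrt w / (sqrt c mu), the source of the constant C. The condition w < c x^2 makes k =
     0 admissible. *)
  assert (Hk1 : exists k, w <= c * (mu^k * x)^2 /\ c * (mu^S k * x)^2 < w).
  { assert (Hex : exists k, c * (mu^k * x)^2 < w).
    { destruct (pow_lt_1_zero mu ltac:(rewrite Rabs_pos_eq; lra) (w / (c * x^2))) as [N HN].
      { apply Rdiv_lt_0_compat; [lra|apply Rmult_lt_0_compat; nra]. }
      exists N. specialize (HN N ltac:(lia)).
      assert (Hm : 0 < mu^N <= 1).
      { split; [apply pow_lt; lra|]. rewrite <- (pow1 N). apply pow_incr; lra. }
      rewrite Rabs_pos_eq in HN by lra.
      apply (Rmult_lt_compat_r (c * x^2)) in HN; [|apply Rmult_lt_0_compat; nra].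
      replace (w / (c * x^2) * (c * x^2)) with w in HN by (field; split; nra).
      apply Rle_lt_trans with (2 := HN). rewrite Rpow_mult_distr.
      assert (0 < c * x^2) by (apply Rmult_lt_0_compat; nra).
      replace (c * ((mu^N)^2 * x^2)) with ((mu^N)^2 * (c * x^2)) by ring.
      apply Rmult_le_compat_r; nra. }
    destruct Hex as [k Hk']. induction k as [|k IH].
    - simpl in Hk'. lra.
    - destruct (Rlt_dec (c * (mu^k * x)^2) w) as [H|H]; [auto|].
      exists k. split; [lra|exact Hk']. }
  destruct Hk1 as [k [Hk1 Hk2]].
  destruct (orbit_region_iter delta w mu x al s (S T0) Hd Hmu Hmuk Hx Hw1 Ho ltac:(lia) Hs1 HR k Hk1)
    as [T HT].
  exists T. intros n Hn. specialize (HT n Hn).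
  assert (Hm : 0 < mu^k) by (apply pow_lt; lra).
  assert (Hxk : 0 < mu^k * x) by nra.
  destruct (region_bounds _ _ _ Hxk ltac:(apply Ha) HT) as [B1 B2].
  assert (B3 : mu^k * x <= / (sqrt c * mu) * sqrt w).
  { apply (Rmult_le_reg_l (sqrt c * mu)); [nra|].
    replace (sqrt c * mu * (/ (sqrt c * mu) * sqrt w)) with (sqrt w) by (field; lra).
    apply Rsqr_incr_0_var; [|apply sqrt_pos]. unfold Rsqr. rewrite sqrt_sqrt by lra.
    replace (sqrt c * mu * (mu^k * x) * (sqrt c * mu * (mu^k * x)))
      with ((sqrt c * sqrt c) * (mu^S k * x)^2) by (simpl; ring).
    rewrite sqrt_sqrt by lra. lra. }
  split; [lra|]. destruct Ho as [_ [_ [Hs _]]]. specialize (Hs n). nra.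
Qed.

(** * Local contraction *)

(** Both the difference and the sum of the arctangents are bounded by those of the arguments. The
    constant 1 yields exactly the coefficient p of the affine model. *)
Lemma atan_sq_lipschitz x y : 0 <= x -> 0 <= y ->
  Rabs (atan x ^ 2 - atan y ^ 2) <= Rabs (x^2 - y^2).
Proof.
  assert (H : forall x y, 0 <= x <= y -> Rabs (atan x ^ 2 - atan y ^ 2) <= Rabs (x^2 - y^2)).
  { clear. intros x y H. pose proof (atan_diff_upper x y H) as H1.
    assert (H2 : (y - x) / (1 + x^2) <= y - x).
    { apply (Rmult_le_reg_r (1 + x^2)); [nra|].
      replace ((y - x) / (1 + x ^ 2) * (1 + x^2)) with (y - x) by (field; nra). nra. }
    pose proof (atan_nondecreasing x y ltac:(lra)).
    pose proof (atan_le_id x ltac:(lra)). pose proof (atan_le_id y ltac:(lra)).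
    pose proof (atan_nondecreasing 0 x ltac:(lra)) as Hx0. rewrite atan_0 in Hx0.
    rewrite !Rabs_left1 by nra. nra. }
  intros Hx Hy. destruct (Rle_dec x y).
  - apply H; lra.
  - rewrite Rabs_minus_sym, (Rabs_minus_sym (x^2)). apply H; lra.
Qed.

Lemma atan_defect_lipschitz X x y : 0 <= x <= X -> 0 <= y <= X ->
  Rabs ((x - atan x) - (y - atan y)) <= X^2 * Rabs (x - y).
Proof.
  assert (H : forall x y, 0 <= x <= y -> y <= X ->
    Rabs ((x - atan x) - (y - atan y)) <= X^2 * Rabs (x - y)).
  { clear. intros x y H HX. pose proof (atan_diff_upper x y H) as H1.
    pose proof (atan_diff_lower x y H) as H3.
    assert (H2 : (y - x) / (1 + x^2) <= y - x).
    { apply (Rmult_le_reg_r (1 + x^2)); [nra|].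
      replace ((y - x) / (1 + x ^ 2) * (1 + x^2)) with (y - x) by (field; nra). nra. }
    assert (H4 : (y - x) * (1 - y^2) <= (y - x) / (1 + y^2)).
    { apply (Rmult_le_reg_r (1 + y^2)); [nra|].
      replace ((y - x) / (1 + y ^ 2) * (1 + y^2)) with (y - x) by (field; nra).
      assert (0 <= (y - x) * (y^2 * y^2)) by (apply Rmult_le_pos; nra). nra. }
    rewrite !Rabs_left1 by lra.
    assert ((y - x) * y^2 <= (y - x) * X^2) by (apply Rmult_le_compat_l; nra). lra. }
  intros Hx Hy. destruct (Rle_dec x y).
  - apply H; lra.
  - rewrite Rabs_minus_sym, (Rabs_minus_sym x). apply H; lra.
Qed.

Lemma atan_defect_bound x : 0 <= x -> 0 <= x - atan x <= x^3.
Proof.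
  intros H. pose proof (atan_le_id x H).
  pose proof (atan_defect_lipschitz x x 0 ltac:(lra) ltac:(lra)) as H1.
  rewrite atan_0, (Rabs_pos_eq (x - 0)) in H1 by lra.
  rewrite Rabs_pos_eq in H1 by lra. split; [lra|]. nra.
Qed.

(* Near the fixed point both [1 - al] and [s] are comparable to the square root
   [h] of the noise level. *)
Definition box C h al s := h / 4 <= 1 - al <= C * h /\ h <= s <= C * h.

Definition defect al s := s - al * atan (s / al).

Lemma atan_ratio_complement al s : 0 < al -> 0 < s ->
  1 - 2 / PI * atan (al / s) = 2 / PI * atan (s / al).
Proof.
  intros Ha Hs. pose proof PI_RGT_0.
  replace (al / s) with (/ (s / al)) by (field; lra).
  rewrite atan_inv by (now apply Rdiv_lt_0_compat). field; lra.
Qed.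

Lemma Q_near_fixpoint al s : 0 < al -> 0 < s ->
  Q al s = (1 - al)^2 + s^2 - 4 / PI * defect al s.
Proof.
  intros Ha Hs. pose proof PI_RGT_0. unfold Q, defect.
  pose proof (atan_ratio_complement al s Ha Hs) as H1.
  assert (H2 : atan (al / s) = PI / 2 - atan (s / al)).
  { replace (atan (al / s)) with (PI / 2 * (1 - (1 - 2 / PI * atan (al / s)))) by (field; lra).
    rewrite H1. field. lra. }
  rewrite H2. field. lra.
Qed.

Lemma box_bounds C h al s : 1 <= C -> 0 < h -> C * h <= 1 / 2 -> box C h al s ->
  1 / 2 <= al < 1 /\ 0 < s <= 1 / 2 /\ 1 <= / al <= 2 /\ al * / al = 1 /\ 0 < s * / al <= 2 * C * h.
Proof.
  intros HC Hh HCh [Hu Hs].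
  assert (Hal : 1 / 2 <= al < 1) by lra.
  assert (E : al * / al = 1) by (field; lra).
  assert (Hi : 1 <= / al <= 2) by (split; nra).
  repeat split; try lra; nra.
Qed.

(** A difference of squares is the difference times the sum, and the lower bounds of the box keep
    the sums of order h. This is where a factor 1 / h is lost. *)
Lemma box_lipschitz_aux C h al1 s1 al2 s2 : 1 <= C -> 0 < h -> C * h <= 1 / 2 ->
  box C h al1 s1 -> box C h al2 s2 ->
  h * Rabs (al1 - al2) <= 2 * Rabs ((1 - al1)^2 - (1 - al2)^2) /\
  2 * h * Rabs (s1 - s2) <= Rabs (s1^2 - s2^2).
Proof.
  intros HC Hh HCh [Hu1 Hs1] [Hu2 Hs2].
  replace ((1 - al1)^2 - (1 - al2)^2) with (- ((al1 - al2) * ((1 - al1) + (1 - al2)))) by ring.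
  replace (s1^2 - s2^2) with ((s1 - s2) * (s1 + s2)) by ring.
  rewrite Rabs_Ropp, !Rabs_mult, (Rabs_pos_eq (1 - al1 + (1 - al2))), (Rabs_pos_eq (s1 + s2)) by lra.
  pose proof (Rabs_pos (al1 - al2)). pose proof (Rabs_pos (s1 - s2)).
  split.
  - assert (Rabs (al1 - al2) * (h / 2) <= Rabs (al1 - al2) * (1 - al1 + (1 - al2)))
      by (apply Rmult_le_compat_l; lra). lra.
  - assert (Rabs (s1 - s2) * (2 * h) <= Rabs (s1 - s2) * (s1 + s2))
      by (apply Rmult_le_compat_l; lra). lra.
Qed.

Lemma phi_sq_lipschitz C h al1 s1 al2 s2 : 1 <= C -> 0 < h -> C * h <= 1 / 2 ->
  box C h al1 s1 -> box C h al2 s2 ->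
  Rabs (atan (s1 / al1) ^ 2 - atan (s2 / al2) ^ 2) <=
    Rabs (s1^2 - s2^2) +
    64 * C^3 * h * (Rabs ((1 - al1)^2 - (1 - al2)^2) + Rabs (s1^2 - s2^2)).
Proof.
  intros HC Hh HCh B1 B2.
  destruct (box_lipschitz_aux C h al1 s1 al2 s2 HC Hh HCh B1 B2) as [Ha _].
  destruct (box_bounds C h al1 s1 HC Hh HCh B1) as [A1 [S1 [I1 [E1 X1]]]].
  destruct (box_bounds C h al2 s2 HC Hh HCh B2) as [A2 [S2 [I2 [E2 X2]]]].
  destruct B1 as [U1 V1]. destruct B2 as [U2 V2].
  apply Rle_trans with (Rabs ((s1 / al1)^2 - (s2 / al2)^2)).
  { apply atan_sq_lipschitz; unfold Rdiv; lra. }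
  unfold Rdiv. set (i1 := / al1) in *. set (i2 := / al2) in *.
  assert (D1 : i1^2 - 1 = (1 - al1) * ((1 + al1) * i1^2)).
  { replace 1 with ((al1 * i1)^2) at 1 by (rewrite E1; ring). ring. }
  assert (D2 : i1^2 - i2^2 = - (al1 - al2) * ((al1 + al2) * (i1^2 * i2^2))).
  { transitivity (i1^2 * (al2 * i2)^2 - i2^2 * (al1*i1)^2); [rewrite E1, E2; ring|ring]. }
  clearbody i1 i2.
  (* The first term carries the main part, as i1^2 = 1 + O(h). In the second, s2^2 = O(h^2) pays for
     the factor 1 / h lost in passing from alpha to (1 - alpha)^2. *)
  replace ((s1 * i1)^2 - (s2 * i2)^2) with ((s1^2 - s2^2) * i1^2 + s2^2 * (i1^2 - i2^2)) by ring.
  apply Rle_trans with (1 := Rabs_triang _ _). rewrite !Rabs_mult.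
  set (dv := Rabs (s1^2 - s2^2)) in *.
  assert (Hdv : 0 <= dv) by apply Rabs_pos.
  set (de := Rabs ((1 - al1)^2 - (1 - al2)^2)) in *.
  assert (Hde : 0 <= de) by apply Rabs_pos.
  assert (Hi1 : i1^2 <= 1 + 8 * C * h).
  { assert ((1 - al1) * ((1 + al1) * i1^2) <= C * h * (2 * 4)) by (apply Rmult_le_compat; nra). lra. }
  assert (HCC : C <= C^3) by (rewrite <- (pow_1 C) at 1; apply Rle_pow; [lra|lia]).
  assert (HCC2 : C^2 <= C^3) by (apply Rle_pow; [lra|lia]).
  rewrite (Rabs_pos_eq (i1^2)) by nra. rewrite (Rabs_pos_eq (s2^2)) by nra.
  assert (T1 : dv * i1^2 <= dv * (1 + 64 * C^3 * h)).
  { assert (C * h <= C^3 * h) by (apply Rmult_le_compat_r; lra).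
    apply Rmult_le_compat_l; [exact Hdv|]. lra. }
  assert (T2 : Rabs (i1^2 - i2^2) <= 32 * Rabs (al1 - al2)).
  { rewrite D2, Rabs_mult, Rabs_Ropp. rewrite Rmult_comm.
    apply Rmult_le_compat_r; [apply Rabs_pos|].
    rewrite Rabs_pos_eq by (apply Rmult_le_pos; nra).
    replace 32 with (2 * (4 * 4)) by ring.
    assert (I1' : 0 <= i1^2 <= 4) by (split; nra).
    assert (I2' : 0 <= i2^2 <= 4) by (split; nra).
    apply Rmult_le_compat; [lra|apply Rmult_le_pos; lra|lra|apply Rmult_le_compat; lra]. }
  assert (T3 : s2^2 * Rabs (i1^2 - i2^2) <= 64 * C^3 * h * de).
  { apply Rle_trans with ((C*h)^2 * (32 * Rabs (al1 - al2))).
    - apply Rmult_le_compat; [nra|apply Rabs_pos|nra|exact T2].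
    - replace ((C*h)^2 * (32 * Rabs (al1 - al2))) with (32 * C^2 * h * (h * Rabs (al1 - al2))) by ring.
      apply Rle_trans with (32 * C^2 * h * (2 * de)).
      + apply Rmult_le_compat_l; [|exact Ha]. apply Rmult_le_pos; [|lra]. apply Rmult_le_pos; nra.
      + assert (C^2 * (h * de) <= C^3 * (h * de)) by (apply Rmult_le_compat_r; [apply Rmult_le_pos|]; lra). lra. }
  lra.
Qed.

(** The defect is al (x - atan x) with x = s / al, cubic in x, so its derivatives are O(h^2); a
    factor h remains after returning to squares. *)
Lemma defect_lipschitz C h al1 s1 al2 s2 : 1 <= C -> 0 < h -> C * h <= 1 / 2 ->
  box C h al1 s1 -> box C h al2 s2 ->
  Rabs (defect al1 s1 - defect al2 s2) <=
    64 * C^3 * h * (Rabs ((1 - al1)^2 - (1 - al2)^2) + Rabs (s1^2 - s2^2)).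
Proof.
  intros HC Hh HCh B1 B2.
  destruct (box_lipschitz_aux C h al1 s1 al2 s2 HC Hh HCh B1 B2) as [Ha Hs].
  destruct (box_bounds C h al1 s1 HC Hh HCh B1) as [A1 [S1 [I1 [E1 X1]]]].
  destruct (box_bounds C h al2 s2 HC Hh HCh B2) as [A2 [S2 [I2 [E2 X2]]]].
  destruct B1 as [U1 V1]. destruct B2 as [U2 V2].
  unfold defect, Rdiv. set (i1 := / al1) in *. set (i2 := / al2) in *. clearbody i1 i2.
  set (x1 := s1 * i1) in *. set (x2 := s2 * i2) in *.
  replace (s1 - al1 * atan x1) with (al1 * (x1 - atan x1))
    by (unfold x1; transitivity ((al1 * i1) * s1 - al1 * atan (s1 * i1)); [ring|rewrite E1; ring]).
  replace (s2 - al2 * atan x2) with (al2 * (x2 - atan x2))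
    by (unfold x2; transitivity ((al2 * i2) * s2 - al2 * atan (s2 * i2)); [ring|rewrite E2; ring]).
  pose proof (atan_defect_bound x1 ltac:(lra)) as Hd1.
  pose proof (atan_defect_lipschitz (2*C*h) x1 x2 ltac:(lra) ltac:(lra)) as Hl.
  assert (Hx : Rabs (x1 - x2) <= 2 * Rabs (s1 - s2) + 4 * C * h * Rabs (al1 - al2)).
  { replace (x1 - x2) with (i1 * (s1 - s2) + (s2 * (i1 * i2)) * - (al1 - al2)).
    - apply Rle_trans with (1 := Rabs_triang _ _). rewrite !(Rabs_mult), Rabs_Ropp.
      pose proof (Rabs_pos (s1 - s2)). pose proof (Rabs_pos (al1 - al2)).
      assert (0 <= s2 * (i1 * i2)) by (apply Rmult_le_pos; [lra|apply Rmult_le_pos; lra]).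
      rewrite (Rabs_pos_eq i1), (Rabs_pos_eq s2), (Rabs_pos_eq i2) by lra.
      apply Rplus_le_compat; apply Rmult_le_compat_r; try lra.
      replace (4 * C * h) with (C * h * (2 * 2)) by ring.
      apply Rmult_le_compat; [lra|apply Rmult_le_pos; lra|lra|apply Rmult_le_compat; lra].
    - unfold x1, x2. transitivity (i1 * (s1 - s2) + s2 * (i1 * (al2 * i2) - i2 * (al1 * i1))).
      + ring.
      + rewrite E1, E2. ring. }
  replace (al1 * (x1 - atan x1) - al2 * (x2 - atan x2))
    with ((x1 - atan x1) * (al1 - al2) + al2 * ((x1 - atan x1) - (x2 - atan x2))) by ring.
  apply Rle_trans with (1 := Rabs_triang _ _). rewrite !Rabs_mult.
  set (dv := Rabs (s1^2 - s2^2)) in *.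
  assert (Hdv : 0 <= dv) by apply Rabs_pos.
  set (de := Rabs ((1 - al1)^2 - (1 - al2)^2)) in *.
  assert (Hde : 0 <= de) by apply Rabs_pos.
  set (da := Rabs (al1 - al2)) in *. assert (Hda : 0 <= da) by apply Rabs_pos.
  set (ds := Rabs (s1 - s2)) in *. assert (Hds : 0 <= ds) by apply Rabs_pos.
  rewrite (Rabs_pos_eq (x1 - atan x1)) by lra. rewrite (Rabs_pos_eq al2) by lra.
  set (c := C * h) in *. assert (Hc : 0 < c <= 1 / 2)
    by (split; [apply Rmult_lt_0_compat; lra|exact HCh]).
  assert (T1 : (x1 - atan x1) * da <= 8 * c^3 * da).
  { apply Rmult_le_compat_r; [exact Hda|]. apply Rle_trans with (x1^3); [lra|].
    replace (8 * c^3) with ((2*C*h)^3) by (unfold c; ring). apply pow_incr. lra. }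
  assert (T2 : al2 * Rabs (x1 - atan x1 - (x2 - atan x2)) <= 1 * ((2*C*h)^2 * (2 * ds + 4 * C * h * da))).
  { apply Rmult_le_compat; [lra|apply Rabs_pos|lra|]. apply Rle_trans with (1 := Hl).
    apply Rmult_le_compat_l; [nra|exact Hx]. }
  replace (1 * ((2*C*h)^2 * (2 * ds + 4 * C * h * da))) with (4 * c^2 * (2 * ds + 4 * c * da)) in T2
    by (unfold c; ring).
  assert (HC3 : C^2 <= C^3) by (apply Rle_pow; [lra|lia]).
  assert (T3 : c^3 * da <= C^3 * h * de).
  { replace (c^3 * da) with (C^2 * h * c * (h * da)) by (unfold c; ring).
    apply Rle_trans with (C^2 * h * c * (2 * de)).
    - apply Rmult_le_compat_l; [|exact Ha]. apply Rmult_le_pos; nra.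
    - apply Rle_trans with (C^2 * h * (1/2) * (2 * de)).
      + apply Rmult_le_compat_r; [lra|]. apply Rmult_le_compat_l; nra.
      + assert (C^2 * (h * de) <= C^3 * (h * de)) by (apply Rmult_le_compat_r; nra). lra. }
  assert (T4 : c^2 * ds <= C^3 * h * dv).
  { replace (c^2 * ds) with (C^2 * h * ((2 * h * ds) / 2)) by (unfold c; field).
    apply Rle_trans with (C^2 * h * dv).
    - apply Rmult_le_compat_l; nra.
    - rewrite !Rmult_assoc. apply Rmult_le_compat_r; nra. }
  assert (0 <= C^3 * h * de) by (repeat apply Rmult_le_pos; nra).
  assert (0 <= C^3 * h * dv) by (repeat apply Rmult_le_pos; nra).
  lra.
Qed.

(** * Convergence inside the box *)

Lemma contraction_weights delta : delta > PI^2 / 4 - 1 ->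
  exists k rho d, 0 < k /\ 0 < rho < 1 /\ 0 < d /\
    / delta + d <= rho * k /\ k * p + / delta + d <= rho.
Proof.
  intros Hd. pose proof (delta_lower _ Hd) as Hd'. pose proof p_bounds as Hp.
  set (g := delta - 1 - p). assert (Hg : 0 < g) by (unfold g; lra).
  assert (Hi : 0 < / delta) by (apply Rinv_0_lt_compat; lra).
  assert (Ei : delta * / delta = 1) by (field; lra).
  (* For the norm k |de| + |dv| the two columns of the affine map require 1 / delta < k and k p + 1
     / delta < 1. This window has length g / (p delta), and k is its midpoint; [d] is a reserve for
     the perturbation. *)
  set (k := / delta + g * / delta * / (2 * p)).
  assert (Hip : 0 < / (2*p)) by (apply Rinv_0_lt_compat; lra).
  assert (Hgi : 0 < g * / delta) by nra.
  assert (Hk : 0 < k) by (unfold k; nra).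
  assert (Ek : k * p = / delta * p + g * / delta / 2) by (unfold k; field; lra).
  assert (Hik : 0 < / (1 + k) <= 1).
  { split; [apply Rinv_0_lt_compat; lra|]. rewrite <- Rinv_1. apply Rinv_le_contravar; lra. }
  set (d := g * / delta / 4 * / (1 + k)).
  assert (Ed : d * (1 + k) = g * / delta / 4) by (unfold d; field; lra).
  assert (Hd0 : 0 < d) by (unfold d; apply Rmult_lt_0_compat; lra).
  assert (Hg1 : g * / delta < 1) by (unfold g; nra).
  assert (Hd1 : d <= g * / delta / 4) by nra.
  exists k, (1 - d), d. repeat split; try lra.
  - assert (1 < / (2*p)) by (apply (Rmult_lt_reg_r (2*p)); [lra|]; rewrite Rinv_l; lra).
    assert (g * / delta < g * / delta * / (2*p)) by nra.
    assert (k = / delta + g * / delta * / (2 * p)) by reflexivity. lra.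
  - rewrite Ek. assert (/ delta * p + / delta = 1 - g * / delta) by (unfold g; nra). lra.
Qed.

Lemma inv_delta_PI_bound delta : delta > PI^2 / 4 - 1 -> 0 < 4 / PI * / delta <= 1.
Proof.
  intros Hd. pose proof (delta_lower _ Hd) as Hd'. pose proof PI_bounds as HP. split.
  - apply Rmult_lt_0_compat; [apply Rdiv_lt_0_compat|apply Rinv_0_lt_compat]; lra.
  - apply (Rmult_le_reg_r (PI * delta)); [nra|].
    replace (4 / PI * / delta * (PI * delta)) with 4 by (field; lra). nra.
Qed.

Lemma orbit_step_lipschitz delta w al s : delta > PI^2 / 4 - 1 -> orbit delta w al s ->
  forall C h, 1 <= C -> 0 < h -> C * h <= 1 / 2 -> (forall n, box C h (al n) (s n)) ->
  forall n,
  let de := Rabs ((1 - al (S n))^2 - (1 - al n)^2) in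
  let dv := Rabs (s (S n)^2 - s n^2) in
  let de' := Rabs ((1 - al (S (S n)))^2 - (1 - al (S n))^2) in
  let dv' := Rabs (s (S (S n))^2 - s (S n)^2) in
  de' <= p * (dv + 64 * C^3 * h * (de + dv)) /\
  dv' <= / delta * (de + dv) + 64 * C^3 * h * (de + dv).
Proof.
  intros Hd Ho C h HC Hh HCh HB n de dv de' dv'.
  pose proof (delta_lower _ Hd) as Hd'. pose proof p_bounds as Hp.
  pose proof (inv_delta_PI_bound _ Hd) as HPd. pose proof PI_RGT_0 as HP0.
  assert (Hi : 0 < / delta) by (apply Rinv_0_lt_compat; lra).
  pose proof (orbit_al_bounds _ _ _ _ Ho) as Ha.
  destruct Ho as [_ [_ [Hs H]]].
  assert (Hu : forall n, (1 - al (S n))^2 = p * atan (s n / al n)^2).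
  { intros m. destruct (H m) as [-> _]. rewrite atan_ratio_complement by (try apply Ha; apply Hs).
    unfold p. field. lra. }
  assert (Hv : forall n, s (S n)^2 = / delta * ((1 - al n)^2 + s n^2) - 4 / PI * / delta * defect (al n) (s n) + w).
  { intros m. destruct (H m) as [_ ->]. rewrite Q_near_fixpoint by (try apply Ha; apply Hs).
    field. lra. }
  pose proof (phi_sq_lipschitz C h _ _ _ _ HC Hh HCh (HB (S n)) (HB n)) as L1.
  pose proof (defect_lipschitz C h _ _ _ _ HC Hh HCh (HB (S n)) (HB n)) as L2.
  fold de dv in L1, L2.
  assert (Hde : 0 <= de) by apply Rabs_pos. assert (Hdv : 0 <= dv) by apply Rabs_pos.
  split.
  - unfold de'. rewrite (Hu (S n)), (Hu n), <- Rmult_minus_distr_l, Rabs_mult, (Rabs_pos_eq p) by lra.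
    apply Rmult_le_compat_l; lra.
  - unfold dv'.
    replace (s (S (S n))^2 - s (S n)^2) with
      (/ delta * (((1 - al (S n))^2 - (1 - al n)^2) + (s (S n)^2 - s n^2))
       + - (4 / PI * / delta * (defect (al (S n)) (s (S n)) - defect (al n) (s n))))
      by (pose proof (Hv (S n)); pose proof (Hv n); lra).
    apply Rle_trans with (1 := Rabs_triang _ _).
    rewrite Rabs_Ropp, (Rabs_mult (/ delta)), (Rabs_mult (4 / PI * / delta)).
    rewrite (Rabs_pos_eq (/ delta)), (Rabs_pos_eq (4 / PI * / delta)) by lra.
    apply Rplus_le_compat.
    + apply Rmult_le_compat_l; [lra|]. apply Rabs_triang.
    + rewrite <- (Rmult_1_l (64 * C^3 * h * (de + dv))).
      apply Rmult_le_compat; [lra|apply Rabs_pos|lra|exact L2].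
Qed.

Lemma geometric_increments_cv (x : nat -> R) B rho : 0 <= rho < 1 ->
  (forall n, Rabs (x (S n) - x n) <= B * rho ^ n) -> exists l, Un_cv x l.
Proof.
  intros Hr H.
  assert (HB : 0 <= B).
  { specialize (H 0%nat). pose proof (Rabs_pos (x 1%nat - x 0%nat)). simpl in H. lra. }
  set (c := B / (1 - rho)).
  assert (Hc : 0 <= c) by (apply Rmult_le_pos; [lra|left; apply Rinv_0_lt_compat; lra]).
  assert (Ec : c * (1 - rho) = B) by (unfold c; field; lra).
  assert (Hrn : forall n, 0 <= rho ^ n) by (intros; apply pow_le; lra).
  assert (Hd : forall n k, Rabs (x (n + k)%nat - x n) <= c * (rho ^ n - rho ^ (n + k))).
  { intros n. induction k as [|k IH].
    - rewrite Nat.add_0_r, !Rminus_diag, Rabs_R0. lra.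
    - replace (x (n + S k)%nat - x n) with ((x (S (n + k)) - x (n + k)%nat) + (x (n + k)%nat - x n))
        by (rewrite Nat.add_succ_r; ring).
      apply Rle_trans with (1 := Rabs_triang _ _). specialize (H (n + k)%nat).
      rewrite <- Ec in H. rewrite Nat.add_succ_r. simpl pow. lra. }
  destruct (R_complete x) as [l Hl]; [|now exists l].
  intros eps He.
  destruct (pow_lt_1_zero rho ltac:(rewrite Rabs_pos_eq; lra) (eps / (2 * (c + 1)))) as [N HN].
  { apply Rdiv_lt_0_compat; lra. }
  exists N.
  assert (HrN : c * rho ^ N < eps / 2).
  { specialize (HN N (le_n N)). rewrite Rabs_pos_eq in HN by apply Hrn.
    apply Rle_lt_trans with ((c + 1) * rho ^ N); [specialize (Hrn N); nra|].
    apply (Rmult_lt_compat_l (c + 1)) in HN; [|lra].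
    apply Rlt_le_trans with (1 := HN). right. field. lra. }
  assert (Hclose : forall n, (n >= N)%nat -> Rabs (x n - x N) < eps / 2).
  { intros n Hn. replace n with (N + (n - N))%nat by lia.
    apply Rle_lt_trans with (1 := Hd N (n - N)%nat). specialize (Hrn (N + (n - N))%nat). nra. }
  intros n m Hn Hm. unfold Rdist.
  replace (x n - x m) with ((x n - x N) + - (x m - x N)) by ring.
  apply Rle_lt_trans with (1 := Rabs_triang _ _). rewrite Rabs_Ropp.
  pose proof (Hclose n Hn). pose proof (Hclose m Hm). lra.
Qed.

Lemma box_orbit_cv delta : delta > PI^2 / 4 - 1 -> forall C, 1 <= C ->
  exists h0, 0 < h0 /\ forall w al s h, 0 < h < h0 -> C * h <= 1 / 2 -> orbit delta w al s ->
    (forall n, box C h (al n) (s n)) ->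
    exists e v, Un_cv (fun n => (1 - al n)^2) e /\ Un_cv (fun n => s n^2) v.
Proof.
  intros Hd C HC. pose proof p_bounds as Hp.
  destruct (contraction_weights delta Hd) as [k [rho [d [Hk [Hr [Hd0 [W1 W2]]]]]]].
  set (K := 64 * C^3). assert (HK : 0 < K) by (unfold K; pose proof (pow_lt C 3); lra).
  (* Below [h0] the perturbation, of weighted size K h (1 + k), fits into the reserve [d]. *)
  set (h0 := d / (K * (1 + k))).
  exists h0. split; [apply Rdiv_lt_0_compat; nra|].
  intros w al s h Hh HCh Ho HB.
  assert (HKh : K * h * (1 + k) <= d).
  { apply Rle_trans with (K * h0 * (1 + k)).
    - apply Rmult_le_compat_r; [lra|]. apply Rmult_le_compat_l; lra.
    - right. unfold h0. field. lra. }
  assert (HKh0 : 0 < K * h) by nra.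
  set (de := fun n => Rabs ((1 - al (S n))^2 - (1 - al n)^2)).
  set (dv := fun n => Rabs (s (S n)^2 - s n^2)).
  assert (Hde : forall n, 0 <= de n) by (intros; apply Rabs_pos).
  assert (Hdv : forall n, 0 <= dv n) by (intros; apply Rabs_pos).
  assert (Hstep : forall n, k * de (S n) + dv (S n) <= rho * (k * de n + dv n)).
  { intros n. destruct (orbit_step_lipschitz delta w al s Hd Ho C h HC ltac:(lra) HCh HB n) as [L1 L2].
    fold (de n) (dv n) (de (S n)) (dv (S n)) K in L1, L2.
    specialize (Hde n). specialize (Hdv n).
    apply (Rmult_le_compat_l k) in L1; [|lra].
    set (E := K * h * (de n + dv n)) in *.
    assert (HE : 0 <= E) by (unfold E; apply Rmult_le_pos; lra).
    assert (kE : k * (p * E) <= k * E) by (apply Rmult_le_compat_l; [lra|]; nra).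
    assert (F1 : E * (1 + k) <= d * (de n + dv n)).
    { unfold E. replace (K * h * (de n + dv n) * (1 + k)) with (K * h * (1 + k) * (de n + dv n)) by ring.
      apply Rmult_le_compat_r; lra. }
    assert (F2 : (/ delta + d) * de n <= rho * k * de n) by (apply Rmult_le_compat_r; lra).
    assert (F3 : (k * p + / delta + d) * dv n <= rho * dv n) by (apply Rmult_le_compat_r; lra).
    lra. }
  set (B := k * de 0%nat + dv 0%nat).
  assert (Hgeo : forall n, k * de n + dv n <= B * rho ^ n).
  { induction n as [|n IH]; [unfold B; simpl; lra|].
    apply Rle_trans with (1 := Hstep n). simpl. nra. }
  destruct (geometric_increments_cv (fun n => (1 - al n)^2) (/ k * B) rho ltac:(lra)) as [e He].
  { intros n. change (de n <= / k * B * rho ^ n). specialize (Hgeo n). specialize (Hdv n).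
    apply (Rmult_le_reg_l k); [lra|].
    replace (k * (/ k * B * rho ^ n)) with (B * rho ^ n) by (field; lra). lra. }
  destruct (geometric_increments_cv (fun n => s n^2) B rho ltac:(lra)) as [v Hv].
  { intros n. change (dv n <= B * rho ^ n). specialize (Hgeo n). specialize (Hde n).
    assert (0 <= k * de n) by (apply Rmult_le_pos; lra). lra. }
  now exists e, v.
Qed.

(** * Value of the limit *)

Lemma Un_cv_Rabs_le (z : nat -> R) l B : Un_cv z l -> (forall n, Rabs (z n) <= B) -> Rabs l <= B.
Proof.
  intros Hz HB. apply Rnot_lt_le. intro H.
  destruct (Hz (Rabs l - B) ltac:(lra)) as [N HN]. specialize (HN N (le_n N)). specialize (HB N).
  unfold Rdist in HN. pose proof (Rabs_triang (- (z N - l)) (z N)) as H1.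
  rewrite Rabs_Ropp in H1. replace (- (z N - l) + z N) with l in H1 by ring. lra.
Qed.

(** Below, atan (s / al) >= atan s >= s - s^3; above, atan (s / al) <= s / al, and 1 / al^2 - 1 =
    O(h). *)
Lemma box_phi_sq C h al s : 1 <= C -> 0 < h -> C * h <= 1 / 2 -> box C h al s ->
  Rabs (atan (s / al) ^ 2 - s^2) <= 8 * C^3 * h^3.
Proof.
  intros HC Hh HCh HB.
  destruct (box_bounds C h al s HC Hh HCh HB) as [A1 [S1 [I1 [E1 X1]]]].
  destruct HB as [U V]. unfold Rdiv. set (i := / al) in *. clearbody i.
  set (c := C * h) in *. replace (8 * C^3 * h^3) with (8 * c^3) by (unfold c; ring).
  assert (Hs0 : 0 < s <= c) by lra. clearbody c.
  assert (Hsi : s <= s * i) by nra.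
  pose proof (atan_nondecreasing s (s * i) Hsi) as H1.
  pose proof (atan_le_id (s * i) ltac:(lra)) as H2.
  pose proof (atan_defect_bound s ltac:(lra)) as H3.
  pose proof (atan_pos s ltac:(lra)) as H4.
  assert (Hup : atan (s * i) ^ 2 <= (s * i)^2) by (apply pow_incr; lra).
  assert (Hlo : atan s ^ 2 <= atan (s * i) ^ 2) by (apply pow_incr; lra).
  assert (D1 : i^2 - 1 = (1 - al) * ((1 + al) * i^2)).
  { replace 1 with ((al * i)^2) at 1 by (rewrite E1; ring). ring. }
  assert (Hi2 : 0 <= i^2 <= 4) by (split; nra).
  assert (Hi : (1 - al) * ((1 + al) * i^2) <= c * (2 * 4)).
  { apply Rmult_le_compat; [lra|apply Rmult_le_pos; lra|lra|apply Rmult_le_compat; lra]. }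
  assert (Hs2 : 0 <= s^2 <= c^2) by (split; [nra|apply pow_incr; lra]).
  assert (Hs3 : 0 <= s^3 <= c^3) by (split; [apply pow_le; lra|apply pow_incr; lra]).
  apply Rabs_le. split.
  - assert (s^2 - 2 * s * s^3 <= atan s ^ 2).
    { assert (s * (s - atan s) <= s * s^3) by (apply Rmult_le_compat_l; lra). nra. }
    assert (s * s^3 <= 1 / 2 * c^3) by (apply Rmult_le_compat; lra). lra.
  - assert (s^2 * (i^2 - 1) <= c^2 * (c * (2 * 4))) by (apply Rmult_le_compat; nra).
    replace ((s * i)^2) with (s^2 + s^2 * (i^2 - 1)) in Hup by ring.
    replace (c^2 * (c * (2*4))) with (8 * c^3) in H by ring. lra.
Qed.

Lemma box_defect C h al s : 1 <= C -> 0 < h -> C * h <= 1 / 2 -> box C h al s ->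
  Rabs (defect al s) <= 8 * C^3 * h^3.
Proof.
  intros HC Hh HCh HB.
  destruct (box_bounds C h al s HC Hh HCh HB) as [A1 [S1 [I1 [E1 X1]]]].
  unfold defect, Rdiv. set (x := s * / al) in *.
  replace (s - al * atan x) with (al * (x - atan x)) by (unfold x; field; lra).
  pose proof (atan_defect_bound x ltac:(lra)) as H.
  assert (x^3 <= (2*C*h)^3) by (apply pow_incr; lra).
  rewrite Rabs_pos_eq by (apply Rmult_le_pos; lra). nra.
Qed.

Lemma Un_cv_const c : Un_cv (fun _ => c) c.
Proof. intros eps He. exists 0%nat. intros n _. rewrite Rdist_eq. exact He. Qed.

Lemma Un_cv_succ (x : nat -> R) l : Un_cv x l -> Un_cv (fun n => x (S n)) l.
Proof. intros H eps He. destruct (H eps He) as [N HN]. exists N. intros n Hn. apply HN. lia. Qed.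

Lemma box_orbit_limit_value delta C : delta > PI^2 / 4 - 1 -> 1 <= C ->
  exists K, forall w al s e v, 0 < w -> C * sqrt w <= 1 / 2 -> orbit delta w al s ->
    (forall n, box C (sqrt w) (al n) (s n)) ->
    Un_cv (fun n => (1 - al n)^2) e -> Un_cv (fun n => s n^2) v ->
    Rabs ((e + v) / w - 1 / (/ (1 + p) - / delta)) <= K * sqrt w.
Proof.
  intros Hd HC. pose proof (delta_lower _ Hd) as Hd'. pose proof p_bounds as Hp.
  pose proof (inv_delta_PI_bound _ Hd) as HPd. pose proof PI_RGT_0 as HP0.
  set (g := 1 - (1 + p) / delta).
  assert (Hg : 0 < g).
  { unfold g. apply (Rmult_lt_reg_r delta); [lra|].
    replace ((1 - (1 + p) / delta) * delta) with (delta - 1 - p) by (field; lra). lra. }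
  set (B := 8 * C^3). assert (HB0 : 0 < B) by (unfold B; pose proof (pow_lt C 3); lra).
  exists ((1 + p) / g * (B + B / delta) + B).
  intros w al s e v Hw HCh Ho HB He Hv.
  set (h := sqrt w) in *. assert (Hh : 0 < h) by (apply sqrt_lt_R0; lra).
  assert (Ew : w = h^2) by (unfold h; simpl; rewrite Rmult_1_r, sqrt_sqrt; lra).
  pose proof (orbit_al_bounds _ _ _ _ Ho) as Ha.
  destruct Ho as [_ [_ [Hs H]]].
  assert (Hi : 0 < / delta) by (apply Rinv_0_lt_compat; lra).
  assert (Hh3 : 0 <= B * h^3) by (apply Rmult_le_pos; [lra|apply pow_le; lra]).
  assert (R1 : Rabs (e - p * v) <= B * h^3).
  { apply (Un_cv_Rabs_le (fun n => (1 - al (S n))^2 - p * s n^2)).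
    - apply CV_minus; [now apply (Un_cv_succ (fun n => (1 - al n)^2))|].
      apply CV_mult; [apply Un_cv_const|exact Hv].
    - intros n. destruct (H n) as [-> _].
      rewrite atan_ratio_complement by (try apply Ha; apply Hs).
      replace ((2 / PI * atan (s n / al n))^2 - p * s n^2)
        with (p * (atan (s n / al n)^2 - s n^2)) by (unfold p; field; lra).
      pose proof (box_phi_sq C h _ _ HC Hh HCh (HB n)) as H1. fold B in H1.
      rewrite Rabs_mult, (Rabs_pos_eq p) by lra.
      pose proof (Rabs_pos (atan (s n / al n)^2 - s n^2)). nra. }
  assert (R2 : Rabs (v - (/ delta * (e + v) + w)) <= B * h^3).
  { apply (Un_cv_Rabs_le (fun n => s (S n)^2 - (/ delta * ((1 - al n)^2 + s n^2) + w))).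
    - apply CV_minus; [now apply (Un_cv_succ (fun n => s n^2))|].
      apply CV_plus; [|apply Un_cv_const].
      apply CV_mult; [apply Un_cv_const|]. now apply CV_plus.
    - intros n. destruct (H n) as [_ ->].
      rewrite Q_near_fixpoint by (try apply Ha; apply Hs).
      replace (((1 - al n)^2 + s n^2 - 4 / PI * defect (al n) (s n)) / delta + w
          - (/ delta * ((1 - al n)^2 + s n^2) + w))
        with (- (4 / PI * / delta * defect (al n) (s n))) by (field; lra).
      pose proof (box_defect C h _ _ HC Hh HCh (HB n)) as H1. fold B in H1.
      rewrite Rabs_Ropp, Rabs_mult, (Rabs_pos_eq (4 / PI * / delta)) by lra.
      pose proof (Rabs_pos (defect (al n) (s n))). nra. }
  set (r1 := e - p * v) in *. set (r2 := v - (/ delta * (e + v) + w)) in *.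
  assert (Edg : delta - (1 + p) <> 0).
  { intro E. assert (g = (delta - (1 + p)) * / delta) by (unfold g; field; lra). rewrite E in *. lra. }
  (* The affine system is solved exactly with residuals: v = (w + r2 + r1 / delta) / g and e + v =
     (1 + p) v + r1. The residuals are O(h^3) and w = h^2, which leaves O(h). *)
  assert (Hev : (e + v) / w - 1 / (/ (1 + p) - / delta) = ((1 + p) / g * (r2 + r1 / delta) + r1) / w).
  { unfold r1, r2, g. field. repeat split; lra. }
  rewrite Hev. unfold Rdiv at 1. rewrite Rabs_mult, (Rabs_pos_eq (/ w))
    by (left; apply Rinv_0_lt_compat; lra).
  apply (Rmult_le_reg_r w); [lra|].
  rewrite Rmult_assoc, Rinv_l, Rmult_1_r by lra.
  replace (((1 + p) / g * (B + B / delta) + B) * h * w)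
    with ((1 + p) / g * (B * h^3 + B * h^3 * / delta) + B * h^3)
    by (rewrite Ew; field; lra).
  assert (Hpg : 0 < (1 + p) / g) by (apply Rdiv_lt_0_compat; lra).
  apply Rle_trans with (1 := Rabs_triang _ _). apply Rplus_le_compat; [|exact R1].
  rewrite Rabs_mult, (Rabs_pos_eq ((1 + p) / g)) by lra.
  apply Rmult_le_compat_l; [lra|].
  apply Rle_trans with (1 := Rabs_triang _ _). apply Rplus_le_compat; [exact R2|].
  unfold Rdiv. rewrite Rabs_mult, (Rabs_pos_eq (/ delta)) by lra.
  apply Rmult_le_compat_r; [lra|exact R1].
Qed.

(** * State evolution *)

Lemma sqrt_lt_of_lt_sq w a : 0 < a -> 0 < w < a^2 -> sqrt w < a.
Proof.
  intros Ha Hw. rewrite <- (sqrt_pow2 a) by lra. apply sqrt_lt_1; lra.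
Qed.

Lemma orbit_shift delta w al s k : 0 < delta -> orbit delta w al s ->
  orbit delta w (fun n => al (n + k)%nat) (fun n => s (n + k)%nat).
Proof.
  intros Hd Ho. pose proof (orbit_al_bounds _ _ _ _ Ho) as Ha.
  pose proof (orbit_s_lower _ _ _ _ Hd Ho) as Hl.
  destruct Ho as [_ [_ [Hs H]]]. repeat split; try apply Ha; try apply Hl; try (intros; apply Hs); apply H.
Qed.

Lemma orbit_mse_limit delta M l0 : delta > PI^2 / 4 - 1 -> 0 < l0 ->
  exists K eta, 0 < eta /\ forall w al s, 0 < w < eta -> orbit delta w al s ->
    s 0%nat ^ 2 <= M -> l0 <= al 0%nat ->
    exists m, Un_cv (fun n => (1 - al n)^2 + s n^2) m /\
      Rabs (m / w - 1 / (/ (1 + p) - / delta)) <= K * sqrt w.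
Proof.
  intros Hd Hl0. pose proof (delta_lower _ Hd) as Hd'. pose proof PI_bounds as HP.
  destruct (orbit_eventually_small delta M l0 Hd Hl0) as [C0 [eta0 [HC0 [Heta0 Hsmall]]]].
  set (C := C0 + 1). assert (HC : 1 <= C) by (unfold C; lra).
  destruct (box_orbit_cv delta Hd C HC) as [h0 [Hh0 Hcv]].
  destruct (box_orbit_limit_value delta C Hd HC) as [K HK].
  set (a := / (2 * C)). assert (Ha0 : 0 < a) by (apply Rinv_0_lt_compat; lra).
  assert (Ea : C * a = 1 / 2) by (unfold a; field; lra).
  exists K, (Rmin eta0 (Rmin (h0^2) (a^2))).
  split; [repeat apply Rmin_glb_lt; nra|].
  intros w al s Hw Ho HM Hl.
  assert (W1 : w < eta0) by (pose proof (Rmin_l eta0 (Rmin (h0^2) (a^2))); lra).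
  pose proof (Rmin_r eta0 (Rmin (h0^2) (a^2))) as W0.
  assert (W2 : w < h0^2) by (pose proof (Rmin_l (h0^2) (a^2)); lra).
  assert (W3 : w < a^2) by (pose proof (Rmin_r (h0^2) (a^2)); lra).
  pose proof (sqrt_lt_of_lt_sq w h0 Hh0 (conj (proj1 Hw) W2)).
  pose proof (sqrt_lt_of_lt_sq w a Ha0 (conj (proj1 Hw) W3)).
  assert (Hh : 0 < sqrt w) by (apply sqrt_lt_R0; lra).
  assert (HCh : C * sqrt w <= 1 / 2) by (rewrite <- Ea; apply Rmult_le_compat_l; lra).
  destruct (Hsmall w al s ltac:(lra) Ho HM Hl) as [T HT].
  pose proof (orbit_al_bounds _ _ _ _ Ho) as Ha.
  pose proof (orbit_s_lower delta w al s ltac:(lra) Ho) as Hsl.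
  assert (Hs1 : forall n, (T <= n)%nat -> sqrt w <= s n <= C * sqrt w).
  { intros n Hn. destruct (HT n Hn) as [_ H2].
    assert (0 < s n) by (destruct Ho as [_ [_ [Hs _]]]; apply Hs).
    split; [|unfold C; lra]. rewrite <- (sqrt_pow2 (s n)) by lra. apply sqrt_le_1_alt. apply Hsl. }
  (* The lower bound on 1 - alpha comes from the preceding iterate, 1 - alpha' = (2 / PI) atan (s /
     al) >= s / 2, hence the shift by [S T]. *)
  assert (HB : forall n, box C (sqrt w) (al (n + S T)%nat) (s (n + S T)%nat)).
  { intros n. split; [|apply Hs1; lia].
    destruct (HT (n + S T)%nat ltac:(lia)) as [H1 _]. split; [|unfold C; lra].
    replace (n + S T)%nat with (S (n + T)) by lia.
    pose proof (Hs1 (n + T)%nat ltac:(lia)) as Hb. destruct (Ha (n + T)%nat) as [Hb' _].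
    destruct Ho as [_ [_ [Hs Hrec]]]. destruct (Hrec (n + T)%nat) as [-> _].
    specialize (Hs (n + T)%nat). set (sn := s (n + T)%nat) in *. set (an := al (n + T)%nat) in *.
    rewrite atan_ratio_complement by lra.
    assert (A1 : sn <= sn / an).
    { apply (Rmult_le_reg_r an); [lra|]. replace (sn / an * an) with sn by (field; lra). nra. }
    pose proof (atan_nondecreasing _ _ A1) as A2.
    pose proof (atan_chord sn ltac:(lra)) as A3.
    apply Rle_trans with (2 / PI * (PI / 4 * sn)).
    - replace (2 / PI * (PI / 4 * sn)) with (sn / 2) by (field; lra). lra.
    - apply Rmult_le_compat_l; [left; apply Rdiv_lt_0_compat|]; lra. }
  pose proof (orbit_shift delta w al s (S T) ltac:(lra) Ho) as Ho'.
  destruct (Hcv _ _ _ (sqrt w) ltac:(lra) HCh Ho' HB) as [e [v [He Hv]]].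
  exists (e + v). split.
  - apply (CV_shift _ (S T)). now apply CV_plus.
  - apply (HK w _ _ e v ltac:(lra) HCh Ho' HB He Hv).
Qed.

Lemma SE_succ delta w a0 s0 t :
  alpha_t delta w a0 s0 (S t) = psi1 (alpha_t delta w a0 s0 t) (sigma2_t delta w a0 s0 t) /\
  sigma2_t delta w a0 s0 (S t) = psi2 (alpha_t delta w a0 s0 t) (sigma2_t delta w a0 s0 t) delta w.
Proof.
  unfold alpha_t, sigma2_t. simpl. destruct (SE delta w a0 s0 t). now split.
Qed.

Lemma psi1_pos al v : 0 < v -> psi1 al v = 2 / PI * atan (al / sqrt v).
Proof.
  intros Hv. pose proof (sqrt_lt_R0 v Hv). unfold psi1, atan_ratio.
  destruct (Req_EM_T (sqrt v) 0); [lra|reflexivity].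
Qed.

Lemma psi2_pos al v delta w : 0 < v -> psi2 al v delta w = Q al (sqrt v) / delta + w.
Proof.
  intros Hv. pose proof (sqrt_lt_R0 v Hv). unfold psi2, atan_ratio, Q.
  destruct (Req_EM_T (sqrt v) 0); [lra|].
  rewrite pow2_sqrt by lra. unfold Rdiv. ring.
Qed.

Lemma psi1_bounds a0 s0 : 0 < a0 -> 0 <= s0 -> 0 < psi1 a0 s0 <= 1.
Proof.
  intros Ha [Hs|<-]; pose proof PI_bounds.
  - rewrite psi1_pos by lra. pose proof (sqrt_lt_R0 s0 Hs).
    pose proof (atan_pos (a0 / sqrt s0) ltac:(now apply Rdiv_lt_0_compat)).
    pose proof (atan_bound (a0 / sqrt s0)).
    assert (0 < 2 / PI) by (apply Rdiv_lt_0_compat; lra).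
    split; [now apply Rmult_lt_0_compat|].
    replace 1 with (2 / PI * (PI / 2)) by (field; lra). apply Rmult_le_compat_l; lra.
  - unfold psi1, atan_ratio, rsign. rewrite sqrt_0.
    destruct (Req_EM_T 0 0); [|lra]. destruct (Rlt_dec 0 a0); [|lra].
    replace (2 / PI * (PI / 2 * 1)) with 1 by (field; lra). lra.
Qed.

Lemma psi2_lower a0 s0 delta w : 0 < delta -> 0 < a0 -> 0 <= s0 -> w <= psi2 a0 s0 delta w.
Proof.
  intros Hd Ha [Hs|<-]; pose proof PI_bounds; pose proof (Rinv_0_lt_compat delta Hd).
  - rewrite psi2_pos by lra. pose proof (Q_nonneg a0 (sqrt s0) Ha (sqrt_lt_R0 s0 Hs)).
    assert (0 <= Q a0 (sqrt s0) / delta) by (apply Rmult_le_pos; lra). lra.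
  - unfold psi2, atan_ratio, rsign. rewrite sqrt_0.
    destruct (Req_EM_T 0 0); [|lra]. destruct (Rlt_dec 0 a0); [|lra].
    replace (a0 ^ 2 + 0 + 1 - 4 * 0 / PI - 4 * a0 / PI * (PI / 2 * 1)) with ((a0 - 1)^2) by (field; lra).
    pose proof (pow2_ge_0 (a0 - 1)).
    assert (0 <= / delta * (a0 - 1)^2) by (apply Rmult_le_pos; lra). lra.
Qed.

Lemma SE_orbit delta w a0 s0 : 0 < delta -> 0 < w -> 0 < a0 -> 0 <= s0 ->
  orbit delta w (fun n => alpha_t delta w a0 s0 (S n)) (fun n => sqrt (sigma2_t delta w a0 s0 (S n))).
Proof.
  intros Hd Hw Ha Hs.
  assert (Hpos : forall n, 0 < alpha_t delta w a0 s0 n /\ 0 <= sigma2_t delta w a0 s0 n).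
  { induction n as [|n [IH1 IH2]]; [split; assumption|].
    destruct (SE_succ delta w a0 s0 n) as [-> ->]. split.
    - now apply psi1_bounds.
    - pose proof (psi2_lower _ _ delta w Hd IH1 IH2). lra. }
  assert (Hv : forall n, w <= sigma2_t delta w a0 s0 (S n)).
  { intros n. destruct (SE_succ delta w a0 s0 n) as [_ ->]. destruct (Hpos n). now apply psi2_lower. }
  repeat split.
  - apply Hpos.
  - destruct (SE_succ delta w a0 s0 0) as [-> _]. now apply psi1_bounds.
  - rewrite pow2_sqrt; [apply Hv|]. apply Hpos.
  - intros n. apply sqrt_lt_R0. specialize (Hv n). lra.
  - destruct (SE_succ delta w a0 s0 (S n)) as [-> _]. apply psi1_pos. specialize (Hv n). lra.
  - rewrite pow2_sqrt by apply Hpos.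
    destruct (SE_succ delta w a0 s0 (S n)) as [_ ->]. apply psi2_pos. specialize (Hv n). lra.
Qed.

Lemma mse_limit_pos delta a0 s0 : delta > PI^2 / 4 - 1 -> 0 < a0 -> 0 <= s0 ->
  exists K eta, 0 < eta /\ forall w, 0 < w < eta ->
    exists m, Un_cv (mse_t delta w a0 s0) m /\
      Rabs (m / w - 1 / (/ (1 + p) - / delta)) <= K * sqrt w.
Proof.
  intros Hd Ha Hs. pose proof (delta_lower _ Hd) as Hd'.
  (* The first iterate of alpha does not depend on w, and that of sigma^2 is the noiseless one plus
     w, hence at most 1 more once w < 1. *)
  destruct (orbit_mse_limit delta (psi2 a0 s0 delta 0 + 1) (psi1 a0 s0) Hd) as [K [eta [Heta H]]].
  { now apply psi1_bounds. }
  exists K, (Rmin 1 eta). split; [apply Rmin_glb_lt; lra|].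
  intros w Hw. pose proof (Rmin_l 1 eta). pose proof (Rmin_r 1 eta).
  pose proof (SE_orbit delta w a0 s0 ltac:(lra) ltac:(lra) Ha Hs) as Ho.
  pose proof (orbit_al_bounds _ _ _ _ Ho) as Hal.
  destruct (H w _ _ ltac:(lra) Ho) as [m [Hm1 Hm2]].
  - destruct (SE_succ delta w a0 s0 0) as [_ E]. rewrite E.
    rewrite pow2_sqrt by (apply Rle_trans with w; [lra|]; apply psi2_lower; auto; lra).
    unfold psi2, alpha_t, sigma2_t; simpl. lra.
  - destruct (SE_succ delta w a0 s0 0) as [-> _]. apply Rle_refl.
  - exists m. split; [|exact Hm2].
    apply (CV_shift _ 1).
    apply Un_cv_ext with (2 := Hm1). intros n. rewrite Nat.add_1_r. unfold mse_t.
    destruct (Hal n) as [Hn _]. rewrite (Rabs_pos_eq (alpha_t _ _ _ _ _)) by lra.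
    rewrite pow2_sqrt; [reflexivity|].
    destruct Ho as [_ [_ [Hsp _]]]. specialize (Hsp n).
    apply Rnot_lt_le. intro Hneg. rewrite sqrt_neg_0 in Hsp by lra. lra.
Qed.

(** * Symmetry in the sign of alpha and conclusion *)

Lemma atan_ratio_opp a s : atan_ratio (- a) s = - atan_ratio a s.
Proof.
  unfold atan_ratio, rsign. destruct (Req_EM_T s 0).
  - destruct (Rlt_dec 0 a), (Rlt_dec a 0), (Rlt_dec 0 (- a)), (Rlt_dec (- a) 0); lra.
  - rewrite <- atan_opp. f_equal. field; lra.
Qed.

Lemma SE_opp delta w a0 s0 t :
  alpha_t delta w (- a0) s0 t = - alpha_t delta w a0 s0 t /\
  sigma2_t delta w (- a0) s0 t = sigma2_t delta w a0 s0 t.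
Proof.
  induction t as [|t [IH1 IH2]]; [now split|].
  destruct (SE_succ delta w (- a0) s0 t) as [-> ->].
  destruct (SE_succ delta w a0 s0 t) as [-> ->].
  rewrite IH1, IH2. unfold psi1, psi2. rewrite atan_ratio_opp.
  split; [ring|]. unfold Rdiv. ring.
Qed.

Lemma mse_t_opp delta w a0 s0 t : mse_t delta w (- a0) s0 t = mse_t delta w a0 s0 t.
Proof. unfold mse_t. destruct (SE_opp delta w a0 s0 t) as [-> ->]. now rewrite Rabs_Ropp. Qed.

Lemma mse_limit delta a0 s0 : delta > PI^2 / 4 - 1 -> a0 <> 0 -> 0 <= s0 ->
  exists K eta, 0 < eta /\ forall w, 0 < w < eta ->
    exists m, Un_cv (mse_t delta w a0 s0) m /\
      Rabs (m / w - 1 / (/ (1 + p) - / delta)) <= K * sqrt w.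
Proof.
  intros Hd Ha Hs. destruct (Rdichotomy a0 0 Ha) as [H|H].
  - destruct (mse_limit_pos delta (- a0) s0 Hd ltac:(lra) Hs) as [K [eta [Heta HK]]].
    exists K, eta. split; [exact Heta|]. intros w Hw. destruct (HK w Hw) as [m [H1 H2]].
    exists m. split; [|exact H2].
    apply Un_cv_ext with (2 := H1). intros n. apply mse_t_opp.
  - now apply mse_limit_pos.
Qed.

Theorem mainTheorem6 (delta a0 s0 : R)
  (Hdelta : delta > PI ^ 2 / 4 - 1) (Ha0 : a0 <> 0) (Hs0 : 0 <= s0) :
  (exists eta : R, eta > 0 /\
     forall sw2 : R, 0 < sw2 < eta ->
       exists l : R, Un_cv (mse_t delta sw2 a0 s0) l) /\
  (forall eps : R, eps > 0 ->
     exists d : R, d > 0 /\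
       forall sw2 : R, 0 < sw2 < d ->
         forall amse : R, Un_cv (mse_t delta sw2 a0 s0) amse ->
           Rabs (amse / sw2 - 1 / (/ (1 + 4 / PI ^ 2) - / delta)) < eps).
Proof.
  destruct (mse_limit delta a0 s0 Hdelta Ha0 Hs0) as [K [eta [Heta H]]].
  split.
  - exists eta. split; [exact Heta|]. intros w Hw. destruct (H w Hw) as [m [Hm _]]. now exists m.
  - intros eps Heps.
    set (a := eps / (Rabs K + 1)).
    assert (HK : 0 < Rabs K + 1) by (pose proof (Rabs_pos K); lra).
    assert (Ha : 0 < a) by (apply Rdiv_lt_0_compat; lra).
    exists (Rmin eta (a^2)). split; [apply Rmin_glb_lt; nra|].
    intros w Hw amse Hcv.
    pose proof (Rmin_l eta (a^2)). pose proof (Rmin_r eta (a^2)).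
    destruct (H w ltac:(lra)) as [m [Hm Hb]].
    (* Uniqueness of limits transfers the K sqrt w estimate to the given [amse]; w < a^2 then makes
       it smaller than [eps]. *)
    rewrite (UL_sequence _ _ _ Hcv Hm). fold p.
    apply Rle_lt_trans with (1 := Hb).
    pose proof (sqrt_lt_of_lt_sq w a Ha ltac:(lra)) as Hsq.
    pose proof (sqrt_lt_R0 w ltac:(lra)).
    pose proof (Rle_abs K).
    assert (E : (Rabs K + 1) * a = eps) by (unfold a; field; lra).
    rewrite <- E. nra.
Qed.
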